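(* Let $\mathsf{P}$ be a principle such that $\mathsf{AMT} \leq_c \mathsf{P}$ and such that $\mathsf{P}$ has an $\omega$-model all of whose members are low sets. Then $\mathsf{P}$ admits no universal instance.
   Context: A principle $\mathsf{P}$ is a statement of the form $\forall X(\Phi(X) \to \exists Y \Psi(X,Y))$ with $\Phi,\Psi$ arithmetical; a set $X$ with $\Phi(X)$ is an instance, and $Y$ with $\Psi(X,Y)$ is a solution to $X$. A Turing degree $\mathbf d$ bounds $\mathsf P$ if every computable instance of $\mathsf P$ has a $\mathbf d$-computable solution; a set bounds $\mathsf P$ if its degree does. $\mathsf P$ admits a universal instance if there is a computable instance $X$ of $\mathsf P$ such that every solution to $X$ bounds $\mathsf P$. $\mathsf{P} \leq_c \mathsf{Q}$ ($\mathsf P$ is computably reducible to $\mathsf Q$) if for every instance $X$ of $\mathsf P$ there is an $X$-computable instance $Y$ of $\mathsf Q$ such that every solution to $Y$ computes, together with $X$, a solution to $X$. An $\omega$-model of $\mathsf P$ is a nonempty collection $\mathcal M$ of subsets of $\omega$ closed under $\oplus$ and Turing reducibility such that every instance of $\mathsf P$ in $\mathcal M$ has a solution in $\mathcal M$. A set $X$ is low if $X' \leq_T \emptyset'$. A formula $\varphi(x_1,\dots,x_n)$ is an atom of a theory $T$ if for every formula $\psi(x_1,\dots,x_n)$ exactly one of $T\vdash \varphi\to\psi$ and $T \vdash \varphi\to\neg\psi$ holds; $T$ is atomic if every formula consistent with $T$ is implied (modulo $T$) by some atom of $T$; a model of $T$ is atomic if every tuple of its elements satisfies an atom of $T$. $\mathsf{AMT}$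 is the principle whose instances are (codes of) complete atomic theories in countable languages and whose solutions are (codes of) atomic models of them. *)

(* Defs.v *)
From Stdlib Require Import Arith List ClassicalEpsilon.
Import ListNotations.

Definition set := nat -> bool.
Definition emptyset : set := fun _ => false.

Definition cpair (a b : nat) : nat := (a + b) * (a + b + 1) / 2 + b.

Fixpoint cunpair (c : nat) : nat * nat :=
  match c with
  | 0 => (0, 0)
  | S c' => let (a, b) := cunpair c' in
            match a with
            | 0 => (S b, 0)
            | S a' => (a', S b)
            end
  end.

Definition cfst (c : nat) : nat := fst (cunpair c).
Definition csnd (c : nat) : nat := snd (cunpair c).

Definition join (X Y : set) : set :=
  fun n => if Nat.odd n then Y (Nat.div2 n) else X (Nat.div2 n).
Definition left_part (X : set) : set := fun n => X (2 * n).
Definition right_part (X : set) : set := fun n => X (2 * n + 1).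

Inductive prog : Type :=
| PZero
| PSucc
| PFst
| PSnd
| POrc
| PComp (f g : prog)
| PPair (f g : prog)
| PRec (f g : prog)
| PMu (f : prog).

(** Step-indexed evaluation: [Some v] means the computation converges to
    [v] (within the given fuel); it is monotone in the fuel. *)
Fixpoint eval (k : nat) (p : prog) (X : set) (x : nat) : option nat :=
  match k with
  | 0 => None
  | S k =>
    match p with
    | PZero => Some 0
    | PSucc => Some (S x)
    | PFst => Some (cfst x)
    | PSnd => Some (csnd x)
    | POrc => Some (if X x then 1 else 0)
    | PComp f g =>
        match eval k g X x with Some y => eval k f X y | None => None end
    | PPair f g =>
        match eval k f X x, eval k g X x with
        | Some a, Some b => Some (cpair a b)
        | _, _ => None
        end
    | PRec f g =>
        let a := cfst x in
        (fix r (n : nat) : option nat :=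
           match n with
           | 0 => eval k f X a
           | S m => match r m with
                    | Some v => eval k g X (cpair a (cpair m v))
                    | None => None
                    end
           end) (csnd x)
    | PMu f =>
        (fix search (j i : nat) : option nat :=
           match j with
           | 0 => None
           | S j' => match eval k f X (cpair x i) with
                     | Some 0 => Some i
                     | Some _ => search j' (S i)
                     | None => None
                     end
           end) k 0
    end
  end.

(** Decoding natural numbers into programs (a computable surjection). *)
Fixpoint dec (fuel c : nat) : prog :=
  match fuel with
  | 0 => PZero
  | S f =>
    let t := cfst c in
    let r := csnd c in
    match t with
    | 0 => PZero
    | 1 => PSucc
    | 2 => PFst
    | 3 => PSnd
    | 4 => POrc
    | 5 => PComp (dec f (cfst r)) (dec f (csnd r))
    | 6 => PPair (dec f (cfst r)) (dec f (csnd r))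
    | 7 => PRec (dec f (cfst r)) (dec f (csnd r))
    | _ => PMu (dec f r)
    end
  end.

Definition decode (e : nat) : prog := dec (S e) e.

Definition conv (e : nat) (X : set) (x v : nat) : Prop :=
  exists k, eval k (decode e) X x = Some v.

Definition halts (e : nat) (X : set) (x : nat) : Prop :=
  exists v, conv e X x v.

Definition Turing_le (Y X : set) : Prop :=
  exists e, forall n, conv e X n (if Y n then 1 else 0).

Definition computable (X : set) : Prop := Turing_le X emptyset.

Definition bool_of_Prop (P : Prop) : bool :=
  if excluded_middle_informative P then true else false.

Definition jump (X : set) : set := fun e => bool_of_Prop (halts e X e).

Definition low (X : set) : Prop := Turing_le (jump X) (jump emptyset).

Inductive aterm : Type :=
| AVar (i : nat)
| AZero
| ASucc (t : aterm)
| APlus (t u : aterm)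
| ATimes (t u : aterm).

Inductive aform : Type :=
| AEq (t u : aterm)
| ALt (t u : aterm)
| AMem (t : aterm) (j : nat)
| ANot (f : aform)
| AAnd (f g : aform)
| AOr (f g : aform)
| AImp (f g : aform)
| AEx (f : aform)
| AAll (f : aform).

Definition scons {A : Type} (a : A) (env : nat -> A) : nat -> A :=
  fun i => match i with 0 => a | S i' => env i' end.

Fixpoint aeval (env : nat -> nat) (t : aterm) : nat :=
  match t with
  | AVar i => env i
  | AZero => 0
  | ASucc t => S (aeval env t)
  | APlus t u => aeval env t + aeval env u
  | ATimes t u => aeval env t * aeval env u
  end.

Fixpoint asat (sets : nat -> set) (env : nat -> nat) (f : aform) : Prop :=
  match f with
  | AEq t u => aeval env t = aeval env u
  | ALt t u => aeval env t < aeval env u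
  | AMem t j => sets j (aeval env t) = true
  | ANot f => ~ asat sets env f
  | AAnd f g => asat sets env f /\ asat sets env g
  | AOr f g => asat sets env f \/ asat sets env g
  | AImp f g => asat sets env f -> asat sets env g
  | AEx f => exists n, asat sets (scons n env) f
  | AAll f => forall n, asat sets (scons n env) f
  end.

(** A principle [forall X (Phi(X) -> exists Y Psi(X,Y))] with [Phi, Psi]
    arithmetical; X is set parameter 0 and Y is set parameter 1. *)
Record principle : Type := Principle {
  pr_inst : aform;
  pr_sol : aform
}.

Definition is_instance (P : principle) (X : set) : Prop :=
  asat (fun j => match j with 0 => X | _ => emptyset end) (fun _ => 0) (pr_inst P).

Definition is_solution (P : principle) (X Y : set) : Prop :=
  asat (fun j => match j with 0 => X | 1 => Y | _ => emptyset end)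
       (fun _ => 0) (pr_sol P).

Section Generic.
Variables (Inst : set -> Prop) (Sol : set -> set -> Prop).

Definition bounds (D : set) : Prop :=
  forall X, computable X -> Inst X -> exists Y, Turing_le Y D /\ Sol X Y.

Definition admits_universal_instance : Prop :=
  exists X, computable X /\ Inst X /\ forall Y, Sol X Y -> bounds Y.

Definition omega_model (M : set -> Prop) : Prop :=
  (exists X, M X) /\
  (forall X Y, M X -> M Y -> M (join X Y)) /\
  (forall X Y, M X -> Turing_le Y X -> M Y) /\
  (forall X, M X -> Inst X -> exists Y, M Y /\ Sol X Y).
End Generic.

Definition c_reducible (Inst1 : set -> Prop) (Sol1 : set -> set -> Prop)
                       (Inst2 : set -> Prop) (Sol2 : set -> set -> Prop) : Prop :=
  forall X, Inst1 X ->
    exists Y, Turing_le Y X /\ Inst2 Y /\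
      forall Z, Sol2 Y Z -> exists W, Turing_le W (join X Z) /\ Sol1 X W.

(** Symbols are natural numbers; symbol [s] with
    [cunpair s = (k, r)], [cunpair r = (a, _)] is a relation symbol if [k]
    is even, a function symbol if [k] is odd (constants: arity 0), and has
    arity [a].  Every (kind, arity, index) occurs.  A language is a set of
    symbols.  Equality is logical. *)
Definition sym_is_fun (s : nat) : bool := Nat.odd (cfst s).
Definition sym_arity (s : nat) : nat := cfst (csnd s).

Inductive term : Type :=
| Var (i : nat)
| App (s : nat) (ts : list term).

Inductive form : Type :=
| Bot
| Eq (t u : term)
| Rel (s : nat) (ts : list term)
| Imp (f g : form)
| All (f : form).

Definition Neg (f : form) : form := Imp f Bot.

Fixpoint wf_term (L : set) (n : nat) (t : term) : Prop :=
  match t with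
  | Var i => i < n
  | App s ts => L s = true /\ sym_is_fun s = true /\ length ts = sym_arity s /\
                (fix all (l : list term) : Prop :=
                   match l with [] => True | t :: l => wf_term L n t /\ all l end) ts
  end.

Fixpoint wf_form (L : set) (n : nat) (f : form) : Prop :=
  match f with
  | Bot => True
  | Eq t u => wf_term L n t /\ wf_term L n u
  | Rel s ts => L s = true /\ sym_is_fun s = false /\ length ts = sym_arity s /\
                Forall (wf_term L n) ts
  | Imp f g => wf_form L n f /\ wf_form L n g
  | All f => wf_form L (S n) f
  end.

Definition sentence (L : set) (f : form) : Prop := wf_form L 0 f.

Fixpoint enc_list (l : list nat) : nat :=
  match l with [] => 0 | x :: l => S (cpair x (enc_list l)) end.

Fixpoint enc_term (t : term) : nat :=
  match t with
  | Var i => cpair 0 i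
  | App s ts => cpair 1 (cpair s (enc_list (map enc_term ts)))
  end.

Fixpoint enc_form (f : form) : nat :=
  match f with
  | Bot => cpair 0 0
  | Eq t u => cpair 1 (cpair (enc_term t) (enc_term u))
  | Rel s ts => cpair 2 (cpair s (enc_list (map enc_term ts)))
  | Imp f g => cpair 3 (cpair (enc_form f) (enc_form g))
  | All f => cpair 4 (enc_form f)
  end.

Record structure (A : Type) : Type := Structure {
  st_dom : A -> Prop;
  st_rel : nat -> list A -> Prop;
  st_fun : nat -> list A -> A
}.
Arguments st_dom {A}. Arguments st_rel {A}. Arguments st_fun {A}.

Definition L_structure {A : Type} (L : set) (M : structure A) : Prop :=
  (exists a, st_dom M a) /\
  forall s (l : list A), L s = true -> sym_is_fun s = true ->
    length l = sym_arity s -> Forall (st_dom M) l -> st_dom M (st_fun M s l).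

Fixpoint teval {A : Type} (M : structure A) (env : nat -> A) (t : term) : A :=
  match t with
  | Var i => env i
  | App s ts => st_fun M s (map (teval M env) ts)
  end.

Fixpoint sat {A : Type} (M : structure A) (env : nat -> A) (f : form) : Prop :=
  match f with
  | Bot => False
  | Eq t u => teval M env t = teval M env u
  | Rel s ts => st_rel M s (map (teval M env) ts)
  | Imp f g => sat M env f -> sat M env g
  | All f => forall a, st_dom M a -> sat M (scons a env) f
  end.

Definition env_in {A : Type} (M : structure A) (env : nat -> A) : Prop :=
  forall i, st_dom M (env i).

Definition models {A : Type} (L T : set) (M : structure A) : Prop :=
  L_structure L M /\
  forall f, sentence L f -> T (enc_form f) = true -> forall env, sat M env f.

(** [T ⊢ f] for a formula [f] (free variables read universally);
    by the completeness theorem this is semantic consequence. *)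
Definition proves (L T : set) (f : form) : Prop :=
  forall (A : Type) (M : structure A), models L T M ->
    forall env, env_in M env -> sat M env f.

Definition consistent (L T : set) : Prop := ~ proves L T Bot.

Definition consistent_with (L T : set) (f : form) : Prop :=
  ~ proves L T (Neg f).

Definition theory_of (L T : set) : Prop :=
  forall c, T c = true -> exists f, c = enc_form f /\ sentence L f.

Definition complete_theory (L T : set) : Prop :=
  theory_of L T /\ consistent L T /\
  forall f, sentence L f -> proves L T f \/ proves L T (Neg f).

Definition atom (L T : set) (n : nat) (f : form) : Prop :=
  wf_form L n f /\
  forall g, wf_form L n g ->
    (proves L T (Imp f g) /\ ~ proves L T (Imp f (Neg g))) \/
    (~ proves L T (Imp f g) /\ proves L T (Imp f (Neg g))).

Definition atomic_theory (L T : set) : Prop :=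
  forall n g, wf_form L n g -> consistent_with L T g ->
    exists f, atom L T n f /\ proves L T (Imp f g).

Definition env_of_list (l : list nat) : nat -> nat := fun i => nth i l 0.

Definition atomic_model {A : Type} (L T : set) (M : structure A) : Prop :=
  models L T M /\
  forall (l : list A) (d : A), Forall (st_dom M) l ->
    exists f, atom L T (length l) f /\ sat M (fun i => nth i l d) f.

Definition AMT_inst (X : set) : Prop :=
  let L := left_part X in let T := right_part X in
  complete_theory L T /\ atomic_theory L T.

Definition AMT_sol (X Y : set) : Prop :=
  let L := left_part X in let T := right_part X in
  let D := left_part Y in let E := right_part Y in
  exists (M : structure nat),
    (forall n, st_dom M n <-> D n = true) /\
    atomic_model L T M /\
    forall c, E c = true <->
      exists f a, c = cpair (enc_form f) (enc_list a) /\
                  wf_form L (length a) f /\ Forall (st_dom M) a /\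
                  sat M (env_of_list a) f.

(* Main.v *)
From Stdlib Require Import Arith List Lia ClassicalEpsilon FunctionalExtensionality.
Require Import Defs.
Import ListNotations.

(* A low set Y never computes atomic models of all computable complete atomic theories; a
   universal instance of P would have a low solution doing so, taken from the omega-model.
   Fix a low Y. Unary predicates name nodes ((n, k), b) with flavour b in {0, 1}, and the set of
   nodes visited by an element is a path starting at some ((n, 0), 0), along which n is fixed
   and k increases. Call a node live if the n-th program with oracle Y maps (n, k) to b. Liveness
   is limit computable as Y is low, and from ((n, k), b) the path may continue to c only if the
   node looks live at stage c: a path is isolated iff it ends at a node that is not live. Since
   one of the two flavours is never live, isolated paths are dense, and the theory requiring
   every finite admissible path to be realized infinitely often is complete (back-and-forth)
   and atomic. If an atomic model were Y-computable, some n would be the index of a program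
   computing the path of an element starting at ((n, 0), 0); all nodes of this path are live, so
   it is not isolated, contradicting that the element satisfies an atom. *)

(** * Pairing *)

(** The obstacle is that the theory must be computable while liveness is only a limit. Letting the
    code of the next node double as the stage at which the previous node is tested makes wrong
    guesses harmless: after a node that is not live only finitely many nodes are ever allowed, after
    a live one all nodes with the same [n], a large enough [k] and flavour at most 1 are. The index
    [k] must increase because the path is to be read as a function: a pair [(n, k)] is then visited
    with at most one flavour, so asking whether [((n, k), 1)] is visited determines the flavour of
    every visited node. No recursion theorem is needed to obtain [n]. A single program reads [n] off
    its argument, searches for an element whose path starts at [((n, 0), 0)] and reports whether
    that path visits [((n, k), 1)]; then [n] is taken to be the index of this very program.
    Infinitely many realizations of every admissible pattern keep the model theory trivial: a
    formula mentions finitely many unary predicates, so a fresh element with the right finite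
    pattern is all that back-and-forth ever asks for. *)

Lemma cpair_step (a b : nat) : cpair a (S b) = S (cpair (S a) b).
Proof. unfold cpair. replace (a + S b) with (S a + b) by lia. lia. Qed.

Lemma cpair_diag (b : nat) : cpair (S b) 0 = S (cpair 0 b).
Proof.
  unfold cpair.
  replace ((S b + 0) * (S b + 0 + 1)) with ((0 + b) * (0 + b + 1) + (b + 1) * 2) by lia.
  rewrite Nat.div_add by lia. lia.
Qed.

Lemma cpair_eta (c : nat) : cpair (cfst c) (csnd c) = c.
Proof.
  unfold cfst, csnd. induction c as [|c IH]; [reflexivity|].
  simpl. destruct (cunpair c) as [a b]; destruct a; simpl in *.
  - rewrite cpair_diag; congruence.
  - rewrite cpair_step; congruence.
Qed.

Lemma cunpair_cpair (a b : nat) : cunpair (cpair a b) = (a, b).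
Proof.
  remember (a + b) as s eqn:Hs. revert a b Hs.
  induction s as [|s IHs].
  - intros a b H. assert (a = 0) by lia. assert (b = 0) by lia. subst. reflexivity.
  - intros a b; revert a. induction b as [|b IHb]; intros a Hs.
    + destruct a; [lia|]. rewrite cpair_diag; simpl. rewrite IHs by lia. reflexivity.
    + rewrite cpair_step; simpl. rewrite IHb by lia. reflexivity.
Qed.

Lemma cfst_cpair (a b : nat) : cfst (cpair a b) = a.
Proof. unfold cfst. rewrite cunpair_cpair. reflexivity. Qed.

Lemma csnd_cpair (a b : nat) : csnd (cpair a b) = b.
Proof. unfold csnd. rewrite cunpair_cpair. reflexivity. Qed.

Lemma cpair_inj (a b a' b' : nat) : cpair a b = cpair a' b' -> a = a' /\ b = b'.
Proof.
  intros H. generalize (f_equal cunpair H). rewrite !cunpair_cpair.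
  intros E; injection E; auto.
Qed.

Lemma cpair_ge (a b : nat) : a + b <= cpair a b.
Proof.
  unfold cpair. assert ((a + b) * 2 / 2 <= (a + b) * (a + b + 1) / 2 \/ a + b = 0).
  { destruct (Nat.eq_dec (a + b) 0); [right; auto|left].
    apply Nat.Div0.div_le_mono. nia. }
  rewrite Nat.div_mul in H by lia. lia.
Qed.

Lemma cfst_le (c : nat) : cfst c <= c.
Proof. pose proof (cpair_ge (cfst c) (csnd c)). rewrite cpair_eta in H. lia. Qed.

Lemma csnd_le (c : nat) : csnd c <= c.
Proof. pose proof (cpair_ge (cfst c) (csnd c)). rewrite cpair_eta in H. lia. Qed.

(** Decoding recurses only below a nonzero tag, so this decrease is what makes the fuel of [dec]
    irrelevant. *)
Lemma csnd_lt (c : nat) : cfst c <> 0 -> csnd c < c.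
Proof. pose proof (cpair_ge (cfst c) (csnd c)). rewrite cpair_eta in H. lia. Qed.

(** * Big-step semantics of programs *)

(** Fuel-free semantics, for inductions on derivations. A function [h] supplies the nonzero values
    of a search, instead of an existential under the quantifier, so that the induction principle
    reaches those premises. *)
Inductive Ev (X : set) : prog -> nat -> nat -> Prop :=
| ev_zero x : Ev X PZero x 0
| ev_succ x : Ev X PSucc x (S x)
| ev_fst x : Ev X PFst x (cfst x)
| ev_snd x : Ev X PSnd x (csnd x)
| ev_orc x : Ev X POrc x (if X x then 1 else 0)
| ev_comp f g x y v : Ev X g x y -> Ev X f y v -> Ev X (PComp f g) x v
| ev_pair f g x a b : Ev X f x a -> Ev X g x b -> Ev X (PPair f g) x (cpair a b)
| ev_rec0 f g x v : csnd x = 0 -> Ev X f (cfst x) v -> Ev X (PRec f g) x v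
| ev_recS f g x m w v :
    csnd x = S m -> Ev X (PRec f g) (cpair (cfst x) m) w ->
    Ev X g (cpair (cfst x) (cpair m w)) v -> Ev X (PRec f g) x v
| ev_mu f x n (h : nat -> nat) :
    (forall i, i < n -> Ev X f (cpair x i) (S (h i))) ->
    Ev X f (cpair x n) 0 -> Ev X (PMu f) x n.

(** This and [mu_loop] name the anonymous inner fixpoints of [eval], to which they are convertible,
    so that statements about them can be proved by induction. *)
Definition rec_loop (k : nat) (f g : prog) (X : set) (a : nat) : nat -> option nat :=
  fix r (n : nat) : option nat :=
    match n with
    | 0 => eval k f X a
    | S m => match r m with
             | Some v => eval k g X (cpair a (cpair m v))
             | None => None
             end
    end.

Definition mu_loop (k : nat) (f : prog) (X : set) (x : nat) : nat -> nat -> option nat :=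
  fix search (j i : nat) : option nat :=
    match j with
    | 0 => None
    | S j' => match eval k f X (cpair x i) with
              | Some 0 => Some i
              | Some _ => search j' (S i)
              | None => None
              end
    end.

Lemma eval_rec (k : nat) (f g : prog) (X : set) (x : nat) :
  eval (S k) (PRec f g) X x = rec_loop k f g X (cfst x) (csnd x).
Proof. reflexivity. Qed.

Lemma eval_mu (k : nat) (f : prog) (X : set) (x : nat) :
  eval (S k) (PMu f) X x = mu_loop k f X x k 0.
Proof. reflexivity. Qed.

Lemma mu_loop_sound (k : nat) (f : prog) (X : set) (x : nat)
  (IH : forall x v, eval k f X x = Some v -> Ev X f x v) :
  forall j i v, mu_loop k f X x j i = Some v ->
    (forall l, l < i -> exists w, Ev X f (cpair x l) (S w)) ->
    Ev X (PMu f) x v.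
Proof.
  induction j as [|j IHj]; simpl; intros i v H Hl; [discriminate|].
  destruct (eval k f X (cpair x i)) as [[|w]|] eqn:E; try discriminate.
  - injection H as <-.
    (* The constructor wants a function on all numbers, so existence is made unconditional before
       [epsilon] chooses. *)
    assert (forall l, exists w, l < i -> Ev X f (cpair x l) (S w)) as C.
    { intros l. destruct (lt_dec l i) as [Hli|Hli].
      - destruct (Hl l Hli) as [w Hw]; exists w; auto.
      - exists 0; intros; lia. }
    apply ev_mu with (h := fun l => epsilon (inhabits 0)
                                      (fun w => l < i -> Ev X f (cpair x l) (S w))).
    + intros l Hli. apply (epsilon_spec (inhabits 0) _ (C l) Hli).
    + apply IH; exact E.
  - apply (IHj _ _ H). intros l Hli.
    destruct (Nat.eq_dec l i) as [->|]; [exists w; apply IH; exact E|].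
    apply Hl; lia.
Qed.

Lemma eval_Ev (X : set) (k : nat) :
  forall p x v, eval k p X x = Some v -> Ev X p x v.
Proof.
  induction k as [|k IH]; [discriminate|].
  intros p x v; destruct p; intros H.
  1-5: injection H as <-; constructor.
  - simpl in H. destruct (eval k p2 X x) eqn:E; [|discriminate].
    econstructor; eauto.
  - simpl in H. destruct (eval k p1 X x) eqn:E; [|discriminate].
    destruct (eval k p2 X x) eqn:E'; [|discriminate].
    injection H as <-. constructor; auto.
  - rewrite eval_rec in H. remember (csnd x) as n eqn:Hn. revert x v Hn H.
    induction n as [|n IHn]; simpl; intros x v Hn H.
    + apply ev_rec0; auto.
    + destruct (rec_loop k p1 p2 X (cfst x) n) as [w|] eqn:E; [|discriminate].
      apply ev_recS with n w; auto.
      apply IHn; rewrite ?cfst_cpair, ?csnd_cpair; auto.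
  - rewrite eval_mu in H. eapply mu_loop_sound; eauto. intros; lia.
Qed.

Lemma eval_mono (X : set) (k : nat) :
  forall k' p x v, k <= k' -> eval k p X x = Some v -> eval k' p X x = Some v.
Proof.
  induction k as [|k IH]; [discriminate|].
  intros [|k'] p x v Hk; [lia|]. apply le_S_n in Hk.
  destruct p; intros H; try exact H.
  - simpl in *. destruct (eval k p2 X x) eqn:E; [|discriminate].
    rewrite (IH k' _ _ _ Hk E); eauto.
  - simpl in *. destruct (eval k p1 X x) eqn:E; [|discriminate].
    destruct (eval k p2 X x) eqn:E'; [|discriminate].
    rewrite (IH k' _ _ _ Hk E), (IH k' _ _ _ Hk E'); auto.
  - rewrite eval_rec in *. generalize dependent v. generalize (csnd x) as n.
    induction n as [|n IHn]; simpl; intros v H; [eauto|].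
    destruct (rec_loop k p1 p2 X (cfst x) n) as [w|] eqn:E; [|discriminate].
    rewrite (IHn w eq_refl); eauto.
  - rewrite eval_mu in *.
    (* The fuel bounds the length of the search as well as each evaluation in it, so both must be
       allowed to grow. *)
    assert (forall j j' i v, j <= j' -> mu_loop k p X x j i = Some v ->
              mu_loop k' p X x j' i = Some v) as G; [|eauto].
    clear v H. induction j as [|j IHj]; simpl; intros j' i v Hj H; [discriminate|].
    destruct j' as [|j']; [lia|]; simpl.
    destruct (eval k p X (cpair x i)) as [[|w]|] eqn:E; try discriminate;
      rewrite (IH k' _ _ _ Hk E); auto.
    apply IHj; auto; lia.
Qed.

Lemma mu_loop_complete (k : nat) (f : prog) (X : set) (x n : nat) :
  (forall i, i < n -> exists w, eval k f X (cpair x i) = Some (S w)) ->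
  eval k f X (cpair x n) = Some 0 ->
  forall d i, i + d = n -> forall j, d < j -> mu_loop k f X x j i = Some n.
Proof.
  intros Hlt Hn. induction d as [|d IH]; intros i Hi j Hj; (destruct j as [|j]; [lia|]); simpl.
  - replace i with n by lia. rewrite Hn. reflexivity.
  - destruct (Hlt i) as [w ->]; [lia|]. apply IH; lia.
Qed.

Lemma Ev_eval (X : set) (p : prog) (x v : nat) :
  Ev X p x v -> exists k, eval k p X x = Some v.
Proof.
  induction 1 as [| | | | |f g x y v _ [k1 H1] _ [k2 H2]|f g x a b _ [k1 H1] _ [k2 H2]
                 |f g x v Hx _ [k H]|f g x m w v Hx _ [k1 H1] _ [k2 H2]|f x n h _ IH _ [k0 H0]].
  1-5: exists 1; reflexivity.
  - exists (S (k1 + k2)); simpl.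
    rewrite (eval_mono X k1 (k1 + k2) _ _ _ ltac:(lia) H1).
    apply (eval_mono X k2); auto; lia.
  - exists (S (k1 + k2)); simpl.
    rewrite (eval_mono X k1 (k1 + k2) _ _ _ ltac:(lia) H1).
    rewrite (eval_mono X k2 (k1 + k2) _ _ _ ltac:(lia) H2). reflexivity.
  - exists (S k). rewrite eval_rec, Hx. exact H.
  - exists (S (k1 + k2)). rewrite eval_rec, Hx.
    assert (H1' := eval_mono X k1 (S (k1 + k2)) _ _ _ ltac:(lia) H1).
    rewrite eval_rec, cfst_cpair, csnd_cpair in H1'. simpl. rewrite H1'.
    apply (eval_mono X k2); auto; lia.
  - assert (exists k, forall i, i < n -> eval k f X (cpair x i) = Some (S (h i))) as [k Hk].
    { clear H0. revert IH. generalize n as N. induction N as [|N IHN]; intros IH.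
      - exists 0; intros; lia.
      - destruct IHN as [k1 Hk1]; [intros; apply IH; lia|].
        destruct (IH N) as [k2 Hk2]; [lia|]. exists (k1 + k2). intros i Hi.
        destruct (Nat.eq_dec i N) as [->|].
        + apply (eval_mono X k2); auto; lia.
        + apply (eval_mono X k1); [lia|]. apply Hk1; lia. }
    (* The fuel has to exceed the number [n + 1] of tests, besides covering every single test. *)
    exists (S (k + k0 + n + 1)). rewrite eval_mu.
    apply mu_loop_complete with (d := n); try lia.
    + intros i Hi. exists (h i). apply (eval_mono X k); [lia|auto].
    + apply (eval_mono X k0); [lia|auto].
Qed.

Lemma Ev_det (X : set) (p : prog) (x v w : nat) : Ev X p x v -> Ev X p x w -> v = w.
Proof.
  intros H1 H2. apply Ev_eval in H1 as [k1 H1]. apply Ev_eval in H2 as [k2 H2].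
  apply (eval_mono X k1 (k1 + k2)) in H1; [|lia].
  apply (eval_mono X k2 (k1 + k2)) in H2; [|lia]. congruence.
Qed.

Lemma conv_Ev (e : nat) (X : set) (x v : nat) : conv e X x v <-> Ev X (decode e) x v.
Proof.
  split.
  - intros [k H]. eapply eval_Ev; eauto.
  - apply Ev_eval.
Qed.

(** * Codes of programs *)

Lemma dec_fuel (c : nat) : forall f f', c < f -> c < f' -> dec f c = dec f' c.
Proof.
  induction c as [c IH] using lt_wf_ind. intros f f' Hf Hf'.
  destruct f as [|f]; [lia|]. destruct f' as [|f']; [lia|]. simpl.
  destruct (cfst c) as [|t] eqn:Et; [reflexivity|].
  assert (csnd c < c) by (apply csnd_lt; lia).
  pose proof (cfst_le (csnd c)). pose proof (csnd_le (csnd c)).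
  do 7 (destruct t as [|t]; [first [reflexivity | f_equal; apply IH; lia]|]).
  f_equal; apply IH; lia.
Qed.

Lemma decode_unfold (e : nat) :
  decode e =
  match cfst e with
  | 0 => PZero
  | 1 => PSucc
  | 2 => PFst
  | 3 => PSnd
  | 4 => POrc
  | 5 => PComp (decode (cfst (csnd e))) (decode (csnd (csnd e)))
  | 6 => PPair (decode (cfst (csnd e))) (decode (csnd (csnd e)))
  | 7 => PRec (decode (cfst (csnd e))) (decode (csnd (csnd e)))
  | _ => PMu (decode (csnd e))
  end.
Proof.
  unfold decode at 1. cbn [dec].
  destruct (cfst e) as [|t] eqn:Et; [reflexivity|].
  assert (csnd e < e) by (apply csnd_lt; lia).
  pose proof (cfst_le (csnd e)). pose proof (csnd_le (csnd e)).
  unfold decode.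
  do 7 (destruct t as [|t]; [first [reflexivity | f_equal; apply dec_fuel; lia]|]).
  f_equal; apply dec_fuel; lia.
Qed.

Fixpoint code (p : prog) : nat :=
  match p with
  | PZero => cpair 0 0
  | PSucc => cpair 1 0
  | PFst => cpair 2 0
  | PSnd => cpair 3 0
  | POrc => cpair 4 0
  | PComp f g => cpair 5 (cpair (code f) (code g))
  | PPair f g => cpair 6 (cpair (code f) (code g))
  | PRec f g => cpair 7 (cpair (code f) (code g))
  | PMu f => cpair 8 (code f)
  end.

Lemma decode_code (p : prog) : decode (code p) = p.
Proof.
  induction p; cbn [code]; rewrite decode_unfold, ?cfst_cpair, ?csnd_cpair, ?cfst_cpair, ?csnd_cpair;
    congruence.
Qed.

(** * Total computable functions *)

(** A semantic predicate with closure properties, so that programs rarely have to be written out.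
    Functions of several arguments are handled through [cpair]. *)
Definition Rec (X : set) (f : nat -> nat) : Prop :=
  exists p, forall n, Ev X p n (f n).

Definition RecB (X : set) (b : nat -> bool) : Prop :=
  Rec X (fun n => if b n then 1 else 0).

Lemma Turing_le_RecB (Y X : set) : Turing_le Y X <-> RecB X Y.
Proof.
  split.
  - intros [e He]. exists (decode e). intros n. apply conv_Ev, He.
  - intros [p Hp]. exists (code p). intros n. apply conv_Ev. rewrite decode_code. apply Hp.
Qed.

Lemma Rec_ext (X : set) (f g : nat -> nat) : (forall n, f n = g n) -> Rec X f -> Rec X g.
Proof. intros E [p Hp]. exists p. intros n. rewrite <- E. apply Hp. Qed.

Lemma RecB_ext (X : set) (f g : nat -> bool) : (forall n, f n = g n) -> RecB X f -> RecB X g.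
Proof. intros E. apply Rec_ext. intros n. rewrite E. reflexivity. Qed.

Lemma Rec_id (X : set) : Rec X (fun n => n).
Proof.
  exists (PPair PFst PSnd). intros n. rewrite <- (cpair_eta n) at 2.
  repeat constructor.
Qed.

Lemma Rec_comp (X : set) (f g : nat -> nat) :
  Rec X f -> Rec X g -> Rec X (fun n => f (g n)).
Proof. intros [p Hp] [q Hq]. exists (PComp p q). intros n. econstructor; eauto. Qed.

Lemma Rec_S (X : set) (f : nat -> nat) : Rec X f -> Rec X (fun n => S (f n)).
Proof. apply Rec_comp with (f := S). exists PSucc. constructor. Qed.

Lemma Rec_cfst (X : set) (f : nat -> nat) : Rec X f -> Rec X (fun n => cfst (f n)).
Proof. apply Rec_comp with (f := cfst). exists PFst. constructor. Qed.

Lemma Rec_csnd (X : set) (f : nat -> nat) : Rec X f -> Rec X (fun n => csnd (f n)).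
Proof. apply Rec_comp with (f := csnd). exists PSnd. constructor. Qed.

Lemma Rec_orc (X : set) (f : nat -> nat) : Rec X f -> RecB X (fun n => X (f n)).
Proof. apply Rec_comp with (f := fun n => if X n then 1 else 0). exists POrc. constructor. Qed.

Lemma Rec_const (X : set) (c : nat) : Rec X (fun _ => c).
Proof.
  induction c as [|c IH].
  - exists PZero. constructor.
  - apply Rec_S, IH.
Qed.

Lemma Rec_cpair (X : set) (f g : nat -> nat) :
  Rec X f -> Rec X g -> Rec X (fun n => cpair (f n) (g n)).
Proof. intros [p Hp] [q Hq]. exists (PPair p q). intros n. constructor; auto. Qed.

Lemma Rec_rec (X : set) (f h : nat -> nat) (g : nat -> nat -> nat -> nat) :
  Rec X h -> Rec X f ->
  Rec X (fun z => g (cfst z) (cfst (csnd z)) (csnd (csnd z))) ->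
  Rec X (fun n => nat_rec (fun _ => nat) (f n) (g n) (h n)).
Proof.
  intros Hh [p Hp] [q Hq].
  (* [PRec] recurses on the second component with the first as parameter, so the parameter [n] is
     paired with the bound [h n]. *)
  apply Rec_ext with
    (f := fun n => (fun z => nat_rec (fun _ => nat) (f (cfst z)) (g (cfst z)) (csnd z)) (cpair n (h n))).
  { intros n. cbv beta. rewrite cfst_cpair, csnd_cpair. reflexivity. }
  refine (Rec_comp X (fun z => nat_rec (fun _ => nat) (f (cfst z)) (g (cfst z)) (csnd z))
            (fun n => cpair n (h n)) _ (Rec_cpair X _ _ (Rec_id X) Hh)).
  exists (PRec p q). intros z. remember (csnd z) as m eqn:Hm. revert z Hm.
  induction m as [|m IH]; intros z Hm; simpl.
  - apply ev_rec0; auto.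
  - eapply ev_recS; [symmetry; exact Hm| |].
    + specialize (IH (cpair (cfst z) m)). rewrite cfst_cpair, csnd_cpair in IH. apply IH. reflexivity.
    + specialize (Hq (cpair (cfst z)
        (cpair m (nat_rec (fun _ => nat) (f (cfst z)) (g (cfst z)) m)))).
      rewrite ?cfst_cpair, ?csnd_cpair, ?cfst_cpair, ?csnd_cpair in Hq. exact Hq.
Qed.

Lemma Rec_mu (X : set) (f : nat -> nat -> bool) (h : nat -> nat) :
  RecB X (fun z => f (cfst z) (csnd z)) ->
  (forall n, f n (h n) = true) -> (forall n i, i < h n -> f n i = false) -> Rec X h.
Proof.
  intros [p Hp] H1 H2.
  (* [PMu] stops at the value 0 whereas truth is coded by 1, so the test is negated first. *)
  assert (Rec X (fun v => 1 - v)) as [q Hq].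
  { apply Rec_ext with (f := fun n => nat_rec (fun _ => nat) 1 (fun _ _ => 0) n).
    - intros [|n]; reflexivity.
    - apply (Rec_rec X (fun _ => 1) (fun n => n) (fun _ _ _ => 0));
        auto using Rec_id, Rec_const. }
  exists (PMu (PComp q p)). intros n. apply ev_mu with (h := fun _ => 0).
  - intros i Hi. econstructor; [apply Hp|].
    rewrite cfst_cpair, csnd_cpair, H2 by auto. apply (Hq 0).
  - econstructor; [apply Hp|]. rewrite cfst_cpair, csnd_cpair, H1. apply (Hq 1).
Qed.

Lemma Rec_pred (X : set) (f : nat -> nat) : Rec X f -> Rec X (fun n => pred (f n)).
Proof.
  intros Hf. apply Rec_ext with (f := fun n => nat_rec (fun _ => nat) 0 (fun m _ => m) (f n)).
  - intros n. destruct (f n); reflexivity.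
  - apply (Rec_rec X (fun _ => 0) f (fun _ m _ => m)); auto using Rec_const, Rec_cfst, Rec_csnd, Rec_id.
Qed.

Lemma Rec_sub (X : set) (f g : nat -> nat) :
  Rec X f -> Rec X g -> Rec X (fun n => f n - g n).
Proof.
  intros Hf Hg. apply Rec_ext with (f := fun n => nat_rec (fun _ => nat) (f n) (fun _ v => pred v) (g n)).
  - intros n. generalize (g n) as m. induction m as [|m IH]; simpl; lia.
  - apply (Rec_rec X f g (fun _ _ v => pred v)); auto using Rec_pred, Rec_csnd, Rec_id.
Qed.

Lemma Rec_if (X : set) (b : nat -> bool) (f g : nat -> nat) :
  RecB X b -> Rec X f -> Rec X g -> Rec X (fun n => if b n then f n else g n).
Proof.
  intros Hb Hf Hg.
  apply Rec_ext with
    (f := fun n => nat_rec (fun _ => nat) (g n) (fun _ _ => f n) (if b n then 1 else 0)).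
  - intros n. destruct (b n); reflexivity.
  - apply (Rec_rec X g (fun n => if b n then 1 else 0) (fun n _ _ => f n)); auto.
    apply (Rec_comp X f cfst); auto using Rec_cfst, Rec_id.
Qed.

Lemma RecB_if (X : set) (b f g : nat -> bool) :
  RecB X b -> RecB X f -> RecB X g -> RecB X (fun n => if b n then f n else g n).
Proof.
  intros Hb Hf Hg.
  apply Rec_ext with (f := fun n => if b n then (if f n then 1 else 0) else (if g n then 1 else 0)).
  - intros n. destruct (b n); reflexivity.
  - apply Rec_if; auto.
Qed.

Lemma RecB_const (X : set) (b : bool) : RecB X (fun _ => b).
Proof. exact (Rec_const X (if b then 1 else 0)). Qed.

Lemma RecB_andb (X : set) (f g : nat -> bool) :
  RecB X f -> RecB X g -> RecB X (fun n => andb (f n) (g n)).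
Proof.
  intros Hf Hg. apply RecB_ext with (f := fun n => if f n then g n else false).
  - intros n; destruct (f n); reflexivity.
  - apply RecB_if; auto using RecB_const.
Qed.

Lemma RecB_orb (X : set) (f g : nat -> bool) :
  RecB X f -> RecB X g -> RecB X (fun n => orb (f n) (g n)).
Proof.
  intros Hf Hg. apply RecB_ext with (f := fun n => if f n then true else g n).
  - intros n; destruct (f n); reflexivity.
  - apply RecB_if; auto using RecB_const.
Qed.

Lemma RecB_negb (X : set) (f : nat -> bool) : RecB X f -> RecB X (fun n => negb (f n)).
Proof.
  intros Hf. apply RecB_ext with (f := fun n => if f n then false else true).
  - intros n; destruct (f n); reflexivity.
  - apply RecB_if; auto using RecB_const.
Qed.

Lemma RecB_is0 (X : set) (f : nat -> nat) : Rec X f -> RecB X (fun n => f n =? 0).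
Proof.
  intros Hf. apply Rec_ext with (f := fun n => 1 - f n).
  - intros n; destruct (f n) as [|[|]]; reflexivity.
  - apply Rec_sub; auto using Rec_const.
Qed.

Lemma RecB_leb (X : set) (f g : nat -> nat) :
  Rec X f -> Rec X g -> RecB X (fun n => f n <=? g n).
Proof.
  intros Hf Hg. apply RecB_ext with (f := fun n => f n - g n =? 0).
  - intros n. destruct (Nat.leb_spec (f n) (g n)).
    + apply Nat.eqb_eq; lia.
    + apply Nat.eqb_neq; lia.
  - apply RecB_is0, Rec_sub; auto.
Qed.

Lemma RecB_ltb (X : set) (f g : nat -> nat) :
  Rec X f -> Rec X g -> RecB X (fun n => f n <? g n).
Proof. intros Hf Hg. apply (RecB_leb X (fun n => S (f n)) g); auto using Rec_S. Qed.

Lemma RecB_eqb (X : set) (f g : nat -> nat) :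
  Rec X f -> Rec X g -> RecB X (fun n => f n =? g n).
Proof.
  intros Hf Hg. apply RecB_ext with (f := fun n => andb (f n <=? g n) (g n <=? f n)).
  - intros n. destruct (Nat.eqb_spec (f n) (g n)) as [->|H].
    + rewrite Nat.leb_refl. reflexivity.
    + destruct (Nat.leb_spec (f n) (g n)); destruct (Nat.leb_spec (g n) (f n)); auto; lia.
  - apply RecB_andb; apply RecB_leb; auto.
Qed.

Lemma Rec_add (X : set) (f g : nat -> nat) :
  Rec X f -> Rec X g -> Rec X (fun n => f n + g n).
Proof.
  intros Hf Hg. apply Rec_ext with (f := fun n => nat_rec (fun _ => nat) (f n) (fun _ v => S v) (g n)).
  - intros n. generalize (g n) as m. induction m as [|m IH]; simpl; lia.
  - apply (Rec_rec X f g (fun _ _ v => S v)); auto using Rec_S, Rec_csnd, Rec_id.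
Qed.

Lemma RecB_odd (X : set) (f : nat -> nat) : Rec X f -> RecB X (fun n => Nat.odd (f n)).
Proof.
  intros Hf. apply Rec_ext with (f := fun n => nat_rec (fun _ => nat) 0 (fun _ v => 1 - v) (f n)).
  - intros n. generalize (f n) as m. induction m as [|m IH]; [reflexivity|].
    rewrite Nat.odd_succ, <- Nat.negb_odd.
    transitivity (1 - (if Nat.odd m then 1 else 0)).
    + rewrite <- IH. reflexivity.
    + destruct (Nat.odd m); reflexivity.
  - apply (Rec_rec X (fun _ => 0) f (fun _ _ v => 1 - v));
      auto using Rec_sub, Rec_const, Rec_csnd, Rec_id.
Qed.

Lemma Rec_div2 (X : set) (f : nat -> nat) : Rec X f -> Rec X (fun n => Nat.div2 (f n)).
Proof.
  intros Hf.
  apply Rec_ext with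
    (f := fun n => nat_rec (fun _ => nat) 0 (fun m v => if Nat.odd m then S v else v) (f n)).
  - intros n. generalize (f n) as m. induction m as [|m IH]; [reflexivity|].
    transitivity (if Nat.odd m then S (Nat.div2 m) else Nat.div2 m).
    { rewrite <- IH. reflexivity. }
    destruct (Nat.odd m) eqn:E.
    + apply Nat.odd_spec in E as [k ->]. replace (S (2 * k + 1)) with (2 * S k) by lia.
      rewrite Nat.div2_double. replace (2 * k + 1) with (S (2 * k)) by lia.
      rewrite Nat.div2_succ_double. reflexivity.
    + rewrite <- Nat.negb_even in E. apply Bool.negb_false_iff, Nat.even_spec in E as [k ->].
      rewrite Nat.div2_double, Nat.div2_succ_double. reflexivity.
  - apply (Rec_rec X (fun _ => 0) f (fun _ m v => if Nat.odd m then S v else v));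
      auto 10 using Rec_if, RecB_odd, Rec_S, Rec_const, Rec_cfst, Rec_csnd, Rec_id.
Qed.

Create HintDb rec.
#[local] Hint Resolve Rec_id Rec_S Rec_cfst Rec_csnd Rec_orc Rec_const Rec_cpair Rec_pred Rec_sub
  Rec_if RecB_if RecB_const RecB_andb RecB_orb RecB_negb RecB_leb RecB_ltb RecB_eqb Rec_add
  RecB_odd Rec_div2 : rec.

(** * Turing reducibility *)

Fixpoint subst_oracle (q p : prog) : prog :=
  match p with
  | POrc => q
  | PComp f g => PComp (subst_oracle q f) (subst_oracle q g)
  | PPair f g => PPair (subst_oracle q f) (subst_oracle q g)
  | PRec f g => PRec (subst_oracle q f) (subst_oracle q g)
  | PMu f => PMu (subst_oracle q f)
  | _ => p
  end.

Lemma Ev_subst_oracle (X Y : set) (q p : prog) (x v : nat) :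
  (forall n, Ev X q n (if Y n then 1 else 0)) ->
  Ev Y p x v -> Ev X (subst_oracle q p) x v.
Proof.
  intros Hq. induction 1; simpl; try (econstructor; eauto; fail).
  apply Hq.
Qed.

Lemma Rec_trans (X Y : set) (f : nat -> nat) : RecB X Y -> Rec Y f -> Rec X f.
Proof.
  intros [q Hq] [p Hp]. exists (subst_oracle q p). intros n.
  eapply Ev_subst_oracle; eauto.
Qed.

Lemma Turing_le_trans (X Y Z : set) : Turing_le X Y -> Turing_le Y Z -> Turing_le X Z.
Proof. rewrite !Turing_le_RecB. intros H1 H2. eapply Rec_trans; eauto. Qed.

Lemma computable_le (X Y : set) : computable X -> Turing_le X Y.
Proof.
  intros H. apply Turing_le_trans with emptyset; auto.
  apply Turing_le_RecB, RecB_const.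
Qed.

Lemma join_le (X Y Z : set) : Turing_le X Z -> Turing_le Y Z -> Turing_le (join X Y) Z.
Proof.
  rewrite !Turing_le_RecB. intros HX HY. unfold join. apply RecB_if.
  - auto with rec.
  - exact (Rec_comp Z (fun n => if Y n then 1 else 0) Nat.div2 HY (Rec_div2 _ _ (Rec_id _))).
  - exact (Rec_comp Z (fun n => if X n then 1 else 0) Nat.div2 HX (Rec_div2 _ _ (Rec_id _))).
Qed.

Lemma Rec_curry (X : set) (F : nat -> nat -> nat) (f g : nat -> nat) :
  Rec X (fun z => F (cfst z) (csnd z)) -> Rec X f -> Rec X g -> Rec X (fun n => F (f n) (g n)).
Proof.
  intros HF Hf Hg.
  apply Rec_ext with (f := fun n => (fun z => F (cfst z) (csnd z)) (cpair (f n) (g n))).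
  - intros n. cbv beta. rewrite cfst_cpair, csnd_cpair. reflexivity.
  - apply (Rec_comp X (fun z => F (cfst z) (csnd z))); auto with rec.
Qed.

Lemma RecB_curry (X : set) (F : nat -> nat -> bool) (f g : nat -> nat) :
  RecB X (fun z => F (cfst z) (csnd z)) -> Rec X f -> Rec X g -> RecB X (fun n => F (f n) (g n)).
Proof. apply (Rec_curry X (fun a b => if F a b then 1 else 0)). Qed.

Lemma RecB_comp (X : set) (b : nat -> bool) (f : nat -> nat) :
  RecB X b -> Rec X f -> RecB X (fun n => b (f n)).
Proof. apply (Rec_comp X (fun n => if b n then 1 else 0)). Qed.

(** * A universal machine *)

(* A configuration either evaluates program [e] at [x] or returns a value, with a stack of
   pending frames; frame tags: 0, 1, 2 for composition and the two halves of pairing,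
   3 for primitive recursion, 4 for search. *)
Definition evl (e x K : nat) : nat := cpair 0 (cpair (cpair e x) K).
Definition ret (v K : nat) : nat := cpair 1 (cpair v K).
(** The successor keeps every nonempty stack apart from the empty stack 0, on which a return is
    final. *)
Definition push (t d K : nat) : nat := S (cpair (cpair t d) K).

Definition step_evl (O : nat -> bool) (e x K : nat) : nat :=
  if cfst e =? 0 then ret 0 K
  else if cfst e =? 1 then ret (S x) K
  else if cfst e =? 2 then ret (cfst x) K
  else if cfst e =? 3 then ret (csnd x) K
  else if cfst e =? 4 then ret (if O x then 1 else 0) K
  else if cfst e =? 5 then evl (csnd (csnd e)) x (push 0 (cfst (csnd e)) K)
  else if cfst e =? 6 then evl (cfst (csnd e)) x (push 1 (cpair (csnd (csnd e)) x) K)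
  else if cfst e =? 7 then
    evl (cfst (csnd e)) (cfst x)
        (push 3 (cpair (csnd (csnd e)) (cpair (cfst x) (cpair 0 (csnd x)))) K)
  else evl (csnd e) (cpair x 0) (push 4 (cpair (csnd e) (cpair x 0)) K).

(** Frame data by tag: 0, the outer program; 1, the second program and the argument; 2, the first
    value; 3, [(g, (a, (i, d)))] with [i] rounds done and [d] to go; 4, [(f, (x, i))] with [i] the
    candidate under test. *)
Definition step_ret (v t d K : nat) : nat :=
  if t =? 0 then evl d v K
  else if t =? 1 then evl (cfst d) (csnd d) (push 2 v K)
  else if t =? 2 then ret (cpair d v) K
  else if t =? 3 then
    if csnd (csnd (csnd d)) =? 0 then ret v K
    else evl (cfst d) (cpair (cfst (csnd d)) (cpair (cfst (csnd (csnd d))) v))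
             (push 3 (cpair (cfst d) (cpair (cfst (csnd d))
                (cpair (S (cfst (csnd (csnd d)))) (pred (csnd (csnd (csnd d))))))) K)
  else if v =? 0 then ret (csnd (csnd d)) K
  else evl (cfst d) (cpair (cfst (csnd d)) (S (csnd (csnd d))))
           (push 4 (cpair (cfst d) (cpair (cfst (csnd d)) (S (csnd (csnd d))))) K).

Definition step (O : nat -> bool) (c : nat) : nat :=
  if cfst c =? 0 then step_evl O (cfst (cfst (csnd c))) (csnd (cfst (csnd c))) (csnd (csnd c))
  else if csnd (csnd c) =? 0 then c
  else step_ret (cfst (csnd c)) (cfst (cfst (pred (csnd (csnd c)))))
                (csnd (cfst (pred (csnd (csnd c))))) (csnd (pred (csnd (csnd c)))).

Definition run (O : nat -> bool) (n c : nat) : nat :=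
  nat_rec (fun _ => nat) c (fun _ => step O) n.

Lemma step_evlE (O : nat -> bool) (e x K : nat) : step O (evl e x K) = step_evl O e x K.
Proof. unfold step, evl. rewrite ?cfst_cpair, ?csnd_cpair, ?cfst_cpair, ?csnd_cpair. reflexivity. Qed.

Lemma step_final (O : nat -> bool) (v : nat) : step O (ret v 0) = ret v 0.
Proof. unfold step, ret. rewrite ?cfst_cpair, ?csnd_cpair, ?csnd_cpair. reflexivity. Qed.

Lemma step_retE (O : nat -> bool) (v t d K : nat) :
  step O (ret v (push t d K)) = step_ret v t d K.
Proof.
  unfold step, ret, push. rewrite ?cfst_cpair, ?csnd_cpair, ?cfst_cpair, ?csnd_cpair.
  cbn [Nat.eqb pred]. rewrite ?cfst_cpair, ?csnd_cpair, ?cfst_cpair, ?csnd_cpair. reflexivity.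
Qed.

Lemma run_S (O : nat -> bool) (n c : nat) : run O (S n) c = run O n (step O c).
Proof.
  induction n as [|n IH]; [reflexivity|].
  change (step O (run O (S n) c) = step O (run O n (step O c))). congruence.
Qed.

Lemma run_add (O : nat -> bool) (n m c : nat) : run O (n + m) c = run O m (run O n c).
Proof.
  revert c. induction n as [|n IH]; intros c; [reflexivity|].
  simpl plus. rewrite !run_S. apply IH.
Qed.

(** Finished configurations are fixed points of [step]: a result reached by some stage persists at
    all later stages, as limits require. *)
Lemma run_final (O : nat -> bool) (n v : nat) : run O n (ret v 0) = ret v 0.
Proof. induction n as [|n IH]; [reflexivity|]. rewrite run_S, step_final. exact IH. Qed.

Definition reach (O : nat -> bool) (c c' : nat) : Prop := exists n, run O n c = c'.

Lemma reach_trans (O : nat -> bool) (a b c : nat) : reach O a b -> reach O b c -> reach O a c.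
Proof. intros [n Hn] [m Hm]. exists (n + m). rewrite run_add. congruence. Qed.

Lemma reach_step (O : nat -> bool) (a b : nat) : reach O (step O a) b -> reach O a b.
Proof. intros [n Hn]. exists (S n). rewrite run_S. exact Hn. Qed.

Lemma reach_refl (O : nat -> bool) (a : nat) : reach O a a.
Proof. exists 0. reflexivity. Qed.

(** Derivations unfold a recursion from the top while the machine iterates from 0; the table [h] of
    intermediate values reconciles the two. *)
Lemma Ev_rec_inv (X : set) (f g : prog) (x v : nat) :
  Ev X (PRec f g) x v ->
  exists h : nat -> nat, Ev X f (cfst x) (h 0) /\ h (csnd x) = v /\
    forall i, i < csnd x -> Ev X g (cpair (cfst x) (cpair i (h i))) (h (S i)).
Proof.
  remember (PRec f g) as p eqn:Hp. induction 1; try discriminate.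
  - injection Hp as -> ->. exists (fun _ => v). rewrite H. repeat split; auto. intros; lia.
  - injection Hp as -> ->. destruct IHEv1 as [h [H2 [H3 H4]]]; [reflexivity|].
    rewrite ?cfst_cpair, ?csnd_cpair in *.
    exists (fun i => if i <=? m then h i else v). rewrite H. repeat split.
    + exact H2.
    + destruct (Nat.leb_spec (S m) m); [lia|reflexivity].
    + intros i Hi. destruct (Nat.leb_spec i m); [|lia].
      destruct (Nat.leb_spec (S i) m).
      * apply H4; lia.
      * replace i with m by lia. rewrite H3. assumption.
Qed.

Ltac unpair := repeat (rewrite cfst_cpair in * || rewrite csnd_cpair in *).

Lemma run_complete (X : set) (p : prog) :
  forall e x v K, decode e = p -> Ev X p x v -> reach X (evl e x K) (ret v K).
Proof.
  induction p; intros e x v K He H; apply reach_step; rewrite step_evlE; unfold step_evl;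
    rewrite decode_unfold in He;
    destruct (cfst e) as [|[|[|[|[|[|[|[|t]]]]]]]]; try discriminate He; cbn [Nat.eqb].
  1-5: inversion H; subst; apply reach_refl.
  - injection He as H1 H2. inversion H; subst.
    eapply reach_trans; [apply IHp2; eauto|].
    apply reach_step. rewrite step_retE. apply IHp1; auto.
  - injection He as H1 H2. inversion H; subst.
    eapply reach_trans; [apply IHp1; eauto|].
    apply reach_step. rewrite step_retE. unfold step_ret; cbn [Nat.eqb]. unpair.
    eapply reach_trans; [apply IHp2; eauto|].
    apply reach_step. rewrite step_retE. apply reach_refl.
  - injection He as H1 H2. apply Ev_rec_inv in H as [h [Hf [Hv Hg]]].
    eapply reach_trans; [apply IHp1; eauto|].
    (* Loop invariant: with [i] rounds done and [d] to go, the value being returned is [h i]. *)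
    assert (forall d i, i + d = csnd x ->
      reach X (ret (h i) (push 3 (cpair (csnd (csnd e)) (cpair (cfst x) (cpair i d))) K)) (ret v K)) as G;
      [|apply G; reflexivity].
    induction d as [|d IHd]; intros i Hi; apply reach_step; rewrite step_retE;
      unfold step_ret; cbn [Nat.eqb]; unpair; cbn [Nat.eqb pred].
    + replace i with (csnd x) by lia. rewrite Hv. apply reach_refl.
    + eapply reach_trans; [apply IHp2; eauto; apply Hg; lia|]. apply IHd; lia.
  - injection He as H1. inversion H as [| | | | | | | | |f' x' n' h Hlt H0]; subst.
    assert (forall d i, i + d = v ->
      reach X (evl (csnd e) (cpair x i) (push 4 (cpair (csnd e) (cpair x i)) K)) (ret v K)) as G;
      [|apply (G v); reflexivity].
    induction d as [|d IHd]; intros i Hi.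
    + eapply reach_trans; [apply IHp; eauto; replace i with v by lia; exact H0|].
      apply reach_step; rewrite step_retE; unfold step_ret; cbn [Nat.eqb]; unpair.
      replace i with v by lia. apply reach_refl.
    + eapply reach_trans; [apply IHp; eauto; apply Hlt; lia|].
      apply reach_step; rewrite step_retE; unfold step_ret; cbn [Nat.eqb]; unpair.
      apply IHd; lia.
Qed.

Lemma ret_push_run (O : nat -> bool) (n v t d K w : nat) :
  run O n (ret v (push t d K)) = ret w 0 ->
  exists m, n = S m /\ run O m (step_ret v t d K) = ret w 0.
Proof.
  destruct n as [|m]; intros H.
  - apply cpair_inj in H as [_ H]. apply cpair_inj in H as [_ H]. discriminate.
  - exists m. rewrite run_S, step_retE in H. auto.
Qed.

(** A run can finish only after its topmost evaluation has returned to the stack [K]. The bound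
    [n <= N] leaves the rest of the run short enough for the induction on length to apply to it
    again. *)
Lemma run_sound (X : set) (N : nat) :
  forall e x K w, run X N (evl e x K) = ret w 0 ->
    exists v n, n <= N /\ Ev X (decode e) x v /\ run X n (ret v K) = ret w 0.
Proof.
  induction N as [N IH] using lt_wf_ind. intros e x K w H.
  destruct N as [|N]; [apply cpair_inj in H as [H _]; discriminate|].
  rewrite run_S, step_evlE in H. unfold step_evl in H. rewrite decode_unfold.
  destruct (cfst e) as [|[|[|[|[|[|[|[|t]]]]]]]]; cbn [Nat.eqb] in H.
  1-5: eexists; exists N; split; [lia|split; [constructor|exact H]].
  - apply IH in H as [v1 [n1 [L1 [E1 H]]]]; [|lia].
    apply ret_push_run in H as [n2 [-> H]].
    apply IH in H as [v2 [n3 [L3 [E3 H]]]]; [|lia].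
    exists v2, n3. split; [lia|split; [econstructor; eauto|exact H]].
  - apply IH in H as [v1 [n1 [L1 [E1 H]]]]; [|lia].
    apply ret_push_run in H as [n2 [-> H]].
    unfold step_ret in H; cbn [Nat.eqb] in H; unpair.
    apply IH in H as [v2 [n3 [L3 [E3 H]]]]; [|lia].
    apply ret_push_run in H as [n4 [-> H]].
    exists (cpair v1 v2), n4. split; [lia|split; [constructor; auto|exact H]].
  - apply IH in H as [v1 [n1 [L1 [E1 H]]]]; [|lia].
    assert (forall d i n v, n <= N -> i + d = csnd x ->
       Ev X (PRec (decode (cfst (csnd e))) (decode (csnd (csnd e)))) (cpair (cfst x) i) v ->
       run X n (ret v (push 3 (cpair (csnd (csnd e)) (cpair (cfst x) (cpair i d))) K)) = ret w 0 ->
       exists v' n', n' <= n /\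
         Ev X (PRec (decode (cfst (csnd e))) (decode (csnd (csnd e)))) (cpair (cfst x) (csnd x)) v' /\
         run X n' (ret v' K) = ret w 0) as G.
    { clear H v1 n1 L1 E1. induction d as [|d IHd]; intros i n v Hn Hi Ei H;
        apply ret_push_run in H as [n2 [-> H]];
        unfold step_ret in H; cbn [Nat.eqb] in H; unpair; cbn [Nat.eqb pred] in H.
      - exists v, n2. replace (csnd x) with i by lia. split; [lia|auto].
      - apply IH in H as [v2 [n3 [L3 [E3 H]]]]; [|lia].
        apply IHd in H as [v3 [n4 [L4 [E4 H]]]]; [|lia|lia|].
        + exists v3, n4. split; [lia|auto].
        + eapply ev_recS; unpair; [reflexivity|eauto|eauto]. }
    apply G in H as [v3 [n4 [L4 [E4 H]]]]; [|lia|reflexivity|].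
    + rewrite cpair_eta in E4. exists v3, n4. split; [lia|auto].
    + apply ev_rec0; unpair; auto.
  (* The number of candidates tested is not known beforehand, so the inner induction is on the
     length of the remaining run. *)
  - assert (forall n i h, n <= N ->
       (forall j, j < i -> Ev X (decode (csnd e)) (cpair x j) (S (h j))) ->
       run X n (evl (csnd e) (cpair x i) (push 4 (cpair (csnd e) (cpair x i)) K)) = ret w 0 ->
       exists v' n', n' <= n /\ Ev X (PMu (decode (csnd e))) x v' /\
         run X n' (ret v' K) = ret w 0) as G.
    { clear H. induction n as [n IHn] using lt_wf_ind. intros i h Hn Hlt H.
      apply IH in H as [v1 [n1 [L1 [E1 H]]]]; [|lia].
      apply ret_push_run in H as [n2 [-> H]].
      unfold step_ret in H; cbn [Nat.eqb] in H; unpair.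
      destruct v1 as [|v1]; cbn [Nat.eqb] in H.
      - exists i, n2. split; [lia|split; [econstructor; eauto|exact H]].
      - apply IHn with (h := fun j => if j =? i then v1 else h j) in H as [v3 [n4 [L4 [E4 H]]]]; try lia.
        + exists v3, n4. split; [lia|auto].
        + intros j Hj. destruct (Nat.eqb_spec j i) as [->|]; [exact E1|]. apply Hlt; lia. }
    apply G with (h := fun _ => 0) in H as [v3 [n4 [L4 [E4 H]]]]; [|lia|intros; lia].
    exists v3, n4. split; [lia|auto].
Qed.

(** The oracle may vary with the argument: the limit lemma simulates a reduction with the
    approximation of the current stage as oracle. *)
Lemma Rec_run (X : set) (O : nat -> nat -> bool) (s n c : nat -> nat) :
  RecB X (fun z => O (cfst z) (csnd z)) -> Rec X s -> Rec X n -> Rec X c ->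
  Rec X (fun z => run (O (s z)) (n z) (c z)).
Proof.
  intros HO Hs Hn Hc. unfold run.
  apply (Rec_rec X c n (fun z _ v => step (O (s z)) v)); auto.
  unfold step, step_evl, step_ret, evl, ret, push.
  assert (forall f, Rec X f -> RecB X (fun z => O (s (cfst z)) (f z))) as HO'.
  { intros f Hf. apply (RecB_curry X O (fun z => s (cfst z))); auto.
    apply (Rec_comp X s); auto with rec. }
  auto 200 with rec.
Qed.

(** * The limit lemma *)

Definition final (c : nat) : bool := andb (cfst c =? 1) (csnd (csnd c) =? 0).

Lemma final_ret (c : nat) : final c = true -> exists v, c = ret v 0.
Proof.
  unfold final. intros H. apply andb_prop in H as [H1 H2].
  apply Nat.eqb_eq in H1, H2. exists (cfst (csnd c)). unfold ret.
  rewrite <- H1, <- H2, !cpair_eta. reflexivity.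
Qed.

Lemma final_ret0 (v : nat) : final (ret v 0) = true.
Proof. unfold final, ret. unpair. reflexivity. Qed.

Definition jump_stage (s e : nat) : bool := final (run emptyset s (evl e e 0)).

Lemma jump_stage_lim (e : nat) :
  exists s0, forall s, s0 <= s -> jump_stage s e = jump emptyset e.
Proof.
  destruct (jump emptyset e) eqn:E; unfold jump, bool_of_Prop in E;
    destruct (excluded_middle_informative _) as [H|H]; try discriminate.
  - destruct H as [v H]. apply conv_Ev in H.
    destruct (run_complete emptyset _ e e v 0 eq_refl H) as [n Hn].
    exists n. intros s Hs. unfold jump_stage.
    replace s with (n + (s - n)) by lia. rewrite run_add, Hn, run_final. apply final_ret0.
  - exists 0. intros s _. apply Bool.not_true_is_false. intros F. apply H.
    apply final_ret in F as [w F]. apply run_sound in F as [v [n [_ [F _]]]].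
    exists v. apply conv_Ev, F.
Qed.

Lemma RecB_jump_stage (X : set) : RecB X (fun z => jump_stage (cfst z) (csnd z)).
Proof.
  unfold jump_stage, final, evl.
  assert (Rec X (fun z => run emptyset (cfst z) (cpair 0 (cpair (cpair (csnd z) (csnd z)) 0)))) as H.
  { apply (Rec_run X (fun _ => emptyset) (fun z => z)); auto with rec. exact (RecB_const X false). }
  auto 20 with rec.
Qed.

(** The use principle: one step queries the oracle at one number at most, so a finite run depends on
    finitely many oracle values. *)
Lemma step_use (O O' : nat -> bool) (c : nat) :
  O (csnd (cfst (csnd c))) = O' (csnd (cfst (csnd c))) -> step O c = step O' c.
Proof. intros H. unfold step, step_evl. rewrite H. reflexivity. Qed.

Lemma run_lim (O : nat -> nat -> bool) (Z : nat -> bool)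
  (H : forall e, exists s0, forall s, s0 <= s -> O s e = Z e) (n : nat) :
  forall c, exists s0, forall s, s0 <= s -> run (O s) n c = run Z n c.
Proof.
  induction n as [|n IH]; intros c; [exists 0; reflexivity|].
  destruct (IH (step Z c)) as [s1 H1]. destruct (H (csnd (cfst (csnd c)))) as [s2 H2].
  exists (s1 + s2). intros s Hs. rewrite !run_S, (step_use _ Z) by (apply H2; lia).
  apply H1; lia.
Qed.

(** At stage [s] the reduction is run for [s] steps on the stage-[s] approximation of the halting
    problem. The true computation is finite, so from some stage on the approximation is correct on
    its use and the run has halted. *)
Lemma limit_lemma (Z : set) :
  Turing_le Z (jump emptyset) ->
  exists A : nat -> nat -> bool, RecB emptyset (fun z => A (cfst z) (csnd z)) /\
    forall x, exists s0, forall s, s0 <= s -> A s x = Z x.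
Proof.
  intros [e He].
  exists (fun s x => cfst (csnd (run (jump_stage s) s (evl e x 0))) =? 1). split.
  - assert (Rec emptyset (fun z => run (jump_stage (cfst z)) (cfst z) (cpair 0 (cpair (cpair e (csnd z)) 0)))).
    { apply (Rec_run _ jump_stage cfst); auto with rec. apply RecB_jump_stage. }
    unfold evl. auto with rec.
  - intros x. specialize (He x). apply conv_Ev in He.
    destruct (run_complete _ _ e x _ 0 eq_refl He) as [n Hn].
    destruct (run_lim jump_stage (jump emptyset) jump_stage_lim n (evl e x 0)) as [s0 Hs0].
    exists (n + s0). intros s Hs. replace (run (jump_stage s) s (evl e x 0)) with (ret (if Z x then 1 else 0) 0).
    + unfold ret. unpair. destruct (Z x); reflexivity.
    + symmetry. replace s with (n + (s - n)) at 2 by lia.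
      rewrite run_add, Hs0, Hn by lia. apply run_final.
Qed.

Fixpoint const_prog (k : nat) : prog :=
  match k with 0 => PZero | S k => PComp PSucc (const_prog k) end.

Lemma Ev_const_prog (X : set) (k x : nat) : Ev X (const_prog k) x k.
Proof. induction k; econstructor; eauto; constructor. Qed.

Lemma Rec_code_const (X : set) (f : nat -> nat) :
  Rec X f -> Rec X (fun n => code (const_prog (f n))).
Proof.
  intros Hf.
  apply Rec_ext with (f := fun n => nat_rec (fun _ => nat) (cpair 0 0)
                       (fun _ v => cpair 5 (cpair (cpair 1 0) v)) (f n)).
  - intros n. generalize (f n) as m. induction m as [|m IH]; [reflexivity|].
    cbn [const_prog code]. rewrite <- IH. reflexivity.
  - apply (Rec_rec X (fun _ => cpair 0 0) f (fun _ _ v => cpair 5 (cpair (cpair 1 0) v)));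
      auto 20 with rec.
Qed.

(* The jump of [Y] decides [conv n Y z b], via the index of the program that runs [n] on [z]
   and halts iff the value is [b]. *)
Lemma low_lim (Y : set) :
  low Y ->
  exists A : nat -> nat -> bool, RecB emptyset (fun z => A (cfst z) (csnd z)) /\
    forall c, exists s0, forall s, s0 <= s ->
      (A s c = true <-> conv (cfst (cfst c)) Y (cfst c) (csnd c)).
Proof.
  intros HY. destruct (limit_lemma _ HY) as [A [HA Hlim]].
  (* The test ignores the search counter, so [PMu t] stops at once on an equal pair and searches
     forever on an unequal one. *)
  assert (RecB Y (fun z => negb (cfst (cfst z) =? csnd (cfst z)))) as [t Ht] by auto 20 with rec.
  (* The code is assembled numerically around the given index, since [code (decode e)] need not be
     [e]. The resulting program ignores its input, so running it on its own index does no harm. *)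
  pose (h := fun c => cpair 5 (cpair (code (PMu t)) (cpair 6 (cpair
     (cpair 5 (cpair (cfst (cfst c)) (code (const_prog (cfst c))))) (code (const_prog (csnd c))))))).
  assert (forall c, jump Y (h c) = true <-> conv (cfst (cfst c)) Y (cfst c) (csnd c)) as Hh.
  { intros c.
    assert (decode (h c) = PComp (PMu t) (PPair (PComp (decode (cfst (cfst c))) (const_prog (cfst c)))
                              (const_prog (csnd c)))) as Hd.
    { unfold h. rewrite decode_unfold. unpair. rewrite decode_code. f_equal.
      rewrite decode_unfold. unpair. rewrite decode_code. f_equal.
      rewrite decode_unfold. unpair. rewrite decode_code. reflexivity. }
    unfold jump, bool_of_Prop. destruct (excluded_middle_informative _) as [H|H].
    - split; [intros _|reflexivity]. destruct H as [v H].
      apply conv_Ev in H. rewrite Hd in H. apply conv_Ev.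
      inversion H as [| | | | |f g x y v' Hg Hf| | | |]; subst.
      inversion Hg as [| | | | | |f' g' x' a b Ha Hb| | |]; subst.
      inversion Ha as [| | | | |f'' g'' x'' y'' v'' Hc Hn| | | |]; subst.
      rewrite (Ev_det _ _ _ _ _ Hc (Ev_const_prog Y _ _)) in Hn.
      rewrite (Ev_det _ _ _ _ _ Hb (Ev_const_prog Y _ _)) in Hf.
      inversion Hf as [| | | | | | | | |f3 x3 n3 h3 Hlt H0]; subst.
      pose proof (Ev_det _ _ _ _ _ H0 (Ht _)) as E. unpair.
      destruct (Nat.eqb_spec a (csnd c)); [|discriminate]. subst. exact Hn.
    - split; [discriminate|]. intros Hc. exfalso. apply H. exists 0. apply conv_Ev.
      rewrite Hd. econstructor.
      + constructor; [econstructor; [apply Ev_const_prog|apply conv_Ev; exact Hc]|apply Ev_const_prog].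
      + apply ev_mu with (h := fun _ => 0); [intros; lia|].
        specialize (Ht (cpair (cpair (csnd c) (csnd c)) 0)). unpair.
        rewrite Nat.eqb_refl in Ht. exact Ht. }
  exists (fun s c => A s (h c)). split.
  - apply (RecB_curry _ A cfst (fun z => h (csnd z))); auto with rec.
    unfold h. auto 20 using Rec_code_const with rec.
  - intros c. destruct (Hlim (h c)) as [s0 Hs0]. exists s0. intros s Hs.
    rewrite Hs0 by auto. apply Hh.
Qed.

(** * Injectivity of the coding of formulas *)

Lemma enc_list_inj {A : Type} (e : A -> nat) (l l' : list A) :
  (forall x y, In x l -> e x = e y -> x = y) ->
  enc_list (map e l) = enc_list (map e l') -> l = l'.
Proof.
  revert l'. induction l as [|x l IH]; intros [|y l'] He H; try discriminate; auto.
  cbn [map enc_list] in H. injection H as H. apply cpair_inj in H as [H1 H2].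
  f_equal; [apply He; simpl; auto|apply IH; auto]. intros; apply He; simpl; auto.
Qed.

Lemma enc_list_In (x : nat) (l : list nat) : In x l -> x < enc_list l.
Proof.
  induction l as [|y l IH]; [intros []|]. cbn [enc_list].
  pose proof (cpair_ge y (enc_list l)). intros [->|H1]; [lia|]. apply IH in H1. lia.
Qed.

(** Strong induction on the code, because the generated induction principle of [term] does not reach
    into argument lists. *)
Lemma enc_term_inj (t t' : term) : enc_term t = enc_term t' -> t = t'.
Proof.
  remember (enc_term t) as n eqn:Hn. revert t t' Hn.
  induction n as [n IH] using lt_wf_ind. intros t t' Hn H. rewrite Hn in H.
  destruct t as [i|s ts], t' as [i'|s' ts']; cbn [enc_term] in *;
    apply cpair_inj in H as [H0 H]; try discriminate; [congruence|].
  apply cpair_inj in H as [-> H]. f_equal. apply enc_list_inj in H; auto.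
  intros x y Hx Hxy. apply IH with (m := enc_term x); auto.
  pose proof (cpair_ge 1 (cpair s' (enc_list (map enc_term ts)))).
  pose proof (cpair_ge s' (enc_list (map enc_term ts))).
  pose proof (enc_list_In _ _ (in_map enc_term _ _ Hx)). lia.
Qed.

Lemma enc_form_inj (f f' : form) : enc_form f = enc_form f' -> f = f'.
Proof.
  revert f'. induction f; intros f' H; destruct f'; cbn [enc_form] in H;
    apply cpair_inj in H as [H0 H]; try discriminate; auto.
  - apply cpair_inj in H as [H1 H2]. f_equal; apply enc_term_inj; auto.
  - apply cpair_inj in H as [-> H]. f_equal. apply enc_list_inj in H; auto.
    intros x y _. apply enc_term_inj.
  - apply cpair_inj in H as [H1 H2]. f_equal; auto.
  - f_equal; auto.
Qed.

(** * Bit patterns *)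

Lemma pattern_code (x : nat -> bool) (N : nat) :
  exists u, forall c, c < N -> Nat.testbit u c = x c.
Proof.
  revert x. induction N as [|N IH]; intros x; [exists 0; intros; lia|].
  destruct (IH (fun c => x (S c))) as [u Hu]. exists (2 * u + Nat.b2n (x 0)).
  intros [|c] Hc; [apply Nat.testbit_0_r|].
  rewrite Nat.testbit_succ_r. apply Hu. lia.
Qed.

Lemma RecB_testbit (X : set) (f g : nat -> nat) :
  Rec X f -> Rec X g -> RecB X (fun n => Nat.testbit (f n) (g n)).
Proof.
  intros Hf Hg.
  apply RecB_ext with (f := fun n => Nat.odd (nat_rec (fun _ => nat) (f n) (fun _ v => Nat.div2 v) (g n))).
  - intros n. generalize (f n) as u, (g n) as c. intros u c.
    replace (nat_rec (fun _ => nat) u (fun _ v => Nat.div2 v) c) with (Nat.shiftr u c).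
    + rewrite <- Nat.bit0_odd, Nat.shiftr_spec by lia. reflexivity.
    + induction c as [|c IH]; [reflexivity|]. simpl. rewrite IH. reflexivity.
  - apply RecB_odd. apply (Rec_rec X f g (fun _ _ v => Nat.div2 v)); auto with rec.
Qed.

(** * Admissible paths *)

(* A path is a set [x] of nodes, visited in increasing order: [B (S c0) c] says that [c] may be
   visited next after [c0], and [B 0 c] that [c] may be visited first. *)
Definition last_node (x : nat -> bool) (N : nat) : nat :=
  nat_rec (fun _ => nat) 0 (fun c v => if x c then S c else v) N.

Definition Adm (B : nat -> nat -> bool) (x : nat -> bool) (N : nat) : Prop :=
  forall c, c < N -> x c = true -> B (last_node x c) c = true.

Definition admb (B : nat -> nat -> bool) (x : nat -> bool) (N : nat) : bool :=
  nat_rec (fun _ => bool) true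
    (fun c ok => if x c then andb ok (B (last_node x c) c) else ok) N.

Lemma admbP (B : nat -> nat -> bool) (x : nat -> bool) (N : nat) :
  admb B x N = true <-> Adm B x N.
Proof.
  induction N as [|N IH]; [split; [intros _ c Hc; lia|reflexivity]|].
  change (admb B x (S N))
    with (if x N then andb (admb B x N) (B (last_node x N) N) else admb B x N).
  split.
  - intros H c Hc Hx. destruct (Nat.eq_dec c N) as [->|].
    + rewrite Hx in H. apply andb_prop in H as [_ H]. exact H.
    + apply IH; auto; [|lia]. destruct (x N); auto. apply andb_prop in H as [H _]. exact H.
  - intros H. assert (admb B x N = true) as -> by (apply IH; intros c Hc; apply H; lia).
    destruct (x N) eqn:E; auto. apply H; auto.
Qed.

Lemma last_node_S (x : nat -> bool) (N : nat) :
  last_node x (S N) = if x N then S N else last_node x N.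
Proof. reflexivity. Qed.

Lemma last_node_ext (x y : nat -> bool) (N : nat) :
  (forall c, c < N -> x c = y c) -> last_node x N = last_node y N.
Proof.
  induction N as [|N IH]; intros H; [reflexivity|].
  rewrite !last_node_S, H, IH by (intros; try apply H; lia). reflexivity.
Qed.

Lemma last_node_gap (x : nat -> bool) (N M : nat) :
  N <= M -> (forall c, N <= c -> c < M -> x c = false) -> last_node x M = last_node x N.
Proof.
  intros H. induction H as [|M H IH]; intros Hx; [reflexivity|].
  rewrite last_node_S, Hx by lia. apply IH. intros; apply Hx; lia.
Qed.

Lemma last_node_visited (x : nat -> bool) (N c : nat) :
  last_node x N = S c -> c < N /\ x c = true.
Proof.
  induction N as [|N IH]; [discriminate|]. rewrite last_node_S.
  destruct (x N) eqn:E; intros H.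
  - injection H as <-. auto.
  - apply IH in H as [H1 H2]. auto.
Qed.

Lemma last_node_pos (x : nat -> bool) (N c : nat) :
  c < N -> x c = true -> exists c0, last_node x N = S c0.
Proof.
  induction N as [|N IH]; intros Hc Hx; [lia|]. rewrite last_node_S.
  destruct (x N) eqn:E; [eauto|]. apply IH; auto.
  destruct (Nat.eq_dec c N); [congruence|lia].
Qed.

Lemma Adm_ext (B : nat -> nat -> bool) (x y : nat -> bool) (N : nat) :
  (forall c, c < N -> x c = y c) -> Adm B x N -> Adm B y N.
Proof.
  intros E H c Hc Hy. rewrite <- (last_node_ext x y) by (intros; apply E; lia).
  apply H; auto. rewrite E; auto.
Qed.

Definition cut (x : nat -> bool) (N : nat) : nat -> bool := fun c => andb (c <? N) (x c).

Lemma cut_lt (x : nat -> bool) (N c : nat) : c < N -> cut x N c = x c.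
Proof. intros H. unfold cut. destruct (Nat.ltb_spec c N); [reflexivity|lia]. Qed.

Lemma cut_ge (x : nat -> bool) (N c : nat) : N <= c -> cut x N c = false.
Proof. intros H. unfold cut. destruct (Nat.ltb_spec c N); [lia|reflexivity]. Qed.

(** Only visits are constrained, so a path may stop anywhere. *)
Lemma Adm_cut (B : nat -> nat -> bool) (x : nat -> bool) (N M : nat) :
  Adm B x N -> Adm B (cut x N) M.
Proof.
  intros H c Hc Hx. destruct (lt_dec c N) as [L|L]; [|rewrite cut_ge in Hx by lia; discriminate].
  apply (Adm_ext B x (cut x N) N); auto. intros; rewrite cut_lt; auto.
Qed.

Lemma Adm_extend (B : nat -> nat -> bool) (x : nat -> bool) (N c : nat) :
  Adm B x N -> N <= c -> B (last_node x N) c = true ->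
  exists y, (forall d, d < N -> y d = x d) /\ y c = true /\ Adm B y (S c) /\ last_node y (S c) = S c.
Proof.
  intros H Hc HB. exists (fun d => orb (cut x N d) (d =? c)).
  assert (forall d, d < N -> orb (cut x N d) (d =? c) = x d) as E.
  { intros d Hd. rewrite cut_lt by auto. destruct (Nat.eqb_spec d c); [lia|]. apply Bool.orb_false_r. }
  assert (forall d, N <= d -> d <> c -> orb (cut x N d) (d =? c) = false) as E'.
  { intros d Hd Hdc. rewrite cut_ge by auto. destruct (Nat.eqb_spec d c); [lia|]. reflexivity. }
  assert (orb (cut x N c) (c =? c) = true) as E'' by (rewrite Nat.eqb_refl; apply Bool.orb_true_r).
  split; [exact E|split; [exact E''|split]].
  - intros d Hd Hx. destruct (lt_dec d N) as [L|L].
    + apply (Adm_ext B x) with (N := N); auto. intros; rewrite E; auto.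
    + destruct (Nat.eq_dec d c) as [->|]; [|rewrite E' in Hx by lia; discriminate].
      rewrite (last_node_gap _ N c) by (auto; intros; apply E'; lia).
      rewrite (last_node_ext _ x) by auto. exact HB.
  - rewrite last_node_S, E''. reflexivity.
Qed.

(** * The theory of a path relation *)

(** In the coding of symbols: kind 0 (a relation), arity 1, index [c]. *)
Definition sym (c : nat) : nat := cpair 0 (cpair 1 c).

Definition lang : set := fun s => andb (cfst s =? 0) (cfst (csnd s) =? 1).

Definition visit (c i : nat) : form := Rel (sym c) [Var i].

Definition lit (b : bool) (c i : nat) : form := if b then visit c i else Neg (visit c i).

(** A chain of implications ending in [Bot] states the negation of the conjunction of its literals.
    Nonexistence is therefore the direct notion, and existence is expressed as its negation. *)
Definition lits (u N : nat) : form :=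
  nat_rec (fun _ => form) Bot (fun c g => Imp (lit (Nat.testbit u c) c 0) g) N.

Definition neqs (i : nat) (f : form) : form :=
  nat_rec (fun _ => form) f (fun k g => Imp (Neg (Eq (Var 0) (Var (S k)))) g) i.

Definition alls (i : nat) (f : form) : form := nat_rec (fun _ => form) f (fun _ g => All g) i.

Definition no_elt (i u N : nat) : form := All (neqs i (lits u N)).

(* The axiom of index [i] codes a pattern [u] of length [N]: if the pattern is admissible, for
   any [i] elements some other element realizes it, otherwise no element realizes it.
   Every pattern has unboundedly large indices, and the [i] outer quantifiers make the code of
   the axiom at least [i]. *)
Definition axm (B : nat -> nat -> bool) (i : nat) : form :=
  alls i (if admb B (Nat.testbit (cfst (cfst i))) (csnd (cfst i))
          then Neg (no_elt i (cfst (cfst i)) (csnd (cfst i)))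
          else no_elt 0 (cfst (cfst i)) (csnd (cfst i))).

(** Since the code of an axiom bounds its index, finitely many axioms need checking: the theory is
    decidable, not merely enumerable. *)
Definition theory (B : nat -> nat -> bool) : set :=
  fun c => existsb (fun i => enc_form (axm B i) =? c) (seq 0 (S c)).

Lemma lang_sym (c : nat) : lang (sym c) = true.
Proof. unfold lang, sym. unpair. reflexivity. Qed.

Lemma lang_inv (s : nat) : lang s = true ->
  sym_is_fun s = false /\ sym_arity s = 1 /\ s = sym (csnd (csnd s)).
Proof.
  unfold lang. intros H. apply andb_prop in H as [H1 H2].
  apply Nat.eqb_eq in H1, H2. unfold sym_is_fun, sym_arity, sym.
  rewrite H1, H2. repeat split.
  rewrite <- H2, cpair_eta, <- H1, cpair_eta. reflexivity.
Qed.

Lemma wf_term_inv (n : nat) (t : term) : wf_term lang n t -> exists i, i < n /\ t = Var i.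
Proof.
  destruct t as [i|s ts]; simpl; [eauto|]. intros [H1 [H2 _]].
  apply lang_inv in H1 as [H1 _]. congruence.
Qed.

Lemma wf_rel_inv (n s : nat) (ts : list term) :
  wf_form lang n (Rel s ts) ->
  s = sym (csnd (csnd s)) /\ exists i, i < n /\ ts = [Var i].
Proof.
  intros [H1 [_ [H2 H3]]]. apply lang_inv in H1 as [_ [H1 Hs]]. rewrite H1 in H2.
  split; [exact Hs|]. destruct ts as [|t [|]]; try discriminate.
  inversion H3; subst. destruct (wf_term_inv n t) as [i [Hi ->]]; eauto.
Qed.

Lemma wf_visit (n c i : nat) : i < n -> wf_form lang n (visit c i).
Proof.
  intros H. simpl. rewrite lang_sym. destruct (lang_inv _ (lang_sym c)) as [-> [-> _]].
  repeat split. repeat constructor. exact H.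
Qed.

Lemma wf_lit (n : nat) (b : bool) (c i : nat) : i < n -> wf_form lang n (lit b c i).
Proof.
  intros H. destruct b; [exact (wf_visit n c i H)|]. split; [exact (wf_visit n c i H)|exact I].
Qed.

Lemma wf_alls (i n : nat) (f : form) : wf_form lang (i + n) f -> wf_form lang n (alls i f).
Proof.
  revert n. induction i as [|i IH]; intros n H; [exact H|].
  change (wf_form lang (S n) (alls i f)). apply IH. rewrite Nat.add_succ_r. exact H.
Qed.

Lemma wf_no_elt (n i u N : nat) : i <= n -> wf_form lang n (no_elt i u N).
Proof.
  intros Hi. change (wf_form lang (S n) (neqs i (lits u N))).
  assert (wf_form lang (S n) (lits u N)) as H.
  { induction N as [|N IH]; [exact I|]. split; [apply wf_lit; lia|exact IH]. }
  induction i as [|i IH]; [exact H|].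
  split; [|apply IH; lia]. simpl. lia.
Qed.

Lemma axm_sentence (B : nat -> nat -> bool) (i : nat) : sentence lang (axm B i).
Proof.
  apply wf_alls. rewrite Nat.add_0_r. destruct (admb _ _ _).
  - split; [apply wf_no_elt; lia|exact I].
  - apply wf_no_elt. lia.
Qed.

Lemma enc_alls_ge (i : nat) (f : form) : i <= enc_form (alls i f).
Proof.
  induction i as [|i IH]; [lia|].
  change (S i <= cpair 4 (enc_form (alls i f))).
  pose proof (cpair_ge 4 (enc_form (alls i f))). lia.
Qed.

Lemma theoryP (B : nat -> nat -> bool) (c : nat) :
  theory B c = true <-> exists i, enc_form (axm B i) = c.
Proof.
  unfold theory. rewrite existsb_exists. split.
  - intros [i [_ H]]. exists i. apply Nat.eqb_eq, H.
  - intros [i <-]. exists i. split; [|apply Nat.eqb_refl].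
    apply in_seq. pose proof (enc_alls_ge i (if admb B (Nat.testbit (cfst (cfst i))) (csnd (cfst i))
          then Neg (no_elt i (cfst (cfst i)) (csnd (cfst i)))
          else no_elt 0 (cfst (cfst i)) (csnd (cfst i)))). unfold axm. lia.
Qed.

(** * Models of the theory *)

Definition path_of {A : Type} (M : structure A) (a : A) : nat -> bool :=
  fun c => bool_of_Prop (st_rel M (sym c) [a]).

(** The semantic content of the axioms, equivalent to being a model by [models_saturated] and
    [saturated_models]. *)
Definition saturated (B : nat -> nat -> bool) {A : Type} (M : structure A) : Prop :=
  (forall a N, st_dom M a -> Adm B (path_of M a) N) /\
  (forall x N l, Adm B x N -> Forall (st_dom M) l ->
     exists a, st_dom M a /\ ~ In a l /\ forall c, c < N -> path_of M a c = x c).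

Lemma bool_of_PropP (P : Prop) : bool_of_Prop P = true <-> P.
Proof.
  unfold bool_of_Prop. destruct (excluded_middle_informative P); split; auto; discriminate.
Qed.

Lemma sat_visit {A : Type} (M : structure A) (env : nat -> A) (c i : nat) :
  sat M env (visit c i) <-> path_of M (env i) c = true.
Proof. unfold path_of. rewrite bool_of_PropP. reflexivity. Qed.

Lemma sat_lit {A : Type} (M : structure A) (env : nat -> A) (b : bool) (c i : nat) :
  sat M env (lit b c i) <-> path_of M (env i) c = b.
Proof.
  destruct b; unfold lit; [apply sat_visit|].
  change (~ sat M env (visit c i) <-> path_of M (env i) c = false).
  rewrite sat_visit. apply Bool.not_true_iff_false.
Qed.

Lemma sat_lits {A : Type} (M : structure A) (env : nat -> A) (u N : nat) :
  sat M env (lits u N) <->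
  ~ (forall c, c < N -> path_of M (env 0) c = Nat.testbit u c).
Proof.
  induction N as [|N IH].
  - split; [intros []|]. intros H. apply H. intros; lia.
  - change ((sat M env (lit (Nat.testbit u N) N 0) -> sat M env (lits u N)) <->
            ~ (forall c, c < S N -> path_of M (env 0) c = Nat.testbit u c)).
    rewrite sat_lit, IH. split.
    + intros H G. apply H; intros; apply G; lia.
    + intros H G F. apply H. intros c Hc.
      destruct (Nat.eq_dec c N) as [->|]; auto. apply F; lia.
Qed.

Lemma sat_neqs {A : Type} (M : structure A) (env : nat -> A) (i : nat) (f : form) :
  sat M env (neqs i f) <-> ((forall k, k < i -> env 0 <> env (S k)) -> sat M env f).
Proof.
  induction i as [|i IH].
  - split; [auto|]. intros H. apply H. intros; lia.
  - change ((env 0 <> env (S i) -> sat M env (neqs i f)) <->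
      ((forall k, k < S i -> env 0 <> env (S k)) -> sat M env f)).
    rewrite IH. split.
    + intros H G. apply H; intros; apply G; lia.
    + intros H G F. apply H. intros k Hk.
      destruct (Nat.eq_dec k i) as [->|]; auto. apply F; lia.
Qed.

Lemma sat_alls {A : Type} (M : structure A) (i : nat) (f : form) (env : nat -> A) :
  sat M env (alls i f) <->
  forall env', (forall k, k < i -> st_dom M (env' k)) -> (forall k, env' (i + k) = env k) ->
    sat M env' f.
Proof.
  revert env. induction i as [|i IH]; intros env.
  - split.
    + intros H env' _ E. replace env' with env; [exact H|].
      apply functional_extensionality. intros k. rewrite <- E. reflexivity.
    + intros H. apply H; auto. intros; lia.
  - change ((forall a, st_dom M a -> sat M (scons a env) (alls i f)) <->
      (forall env', (forall k, k < S i -> st_dom M (env' k)) ->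
         (forall k, env' (S i + k) = env k) -> sat M env' f)).
    split.
    + intros H env' Hd E. apply (proj1 (IH (scons (env' i) env))).
      * apply H, Hd. lia.
      * intros; apply Hd; lia.
      * intros [|k]; simpl; [f_equal; lia|]. rewrite <- E. f_equal. lia.
    + intros H a Ha. apply IH. intros env' Hd E. apply H.
      * intros k Hk. destruct (Nat.eq_dec k i) as [->|]; [|apply Hd; lia].
        specialize (E 0). rewrite Nat.add_0_r in E. simpl in E. congruence.
      * intros k. specialize (E (S k)). simpl in E. rewrite <- E. f_equal. lia.
Qed.

Lemma sat_no_elt {A : Type} (M : structure A) (env : nat -> A) (i u N : nat) :
  sat M env (no_elt i u N) <->
  ~ exists a, st_dom M a /\ (forall k, k < i -> a <> env k) /\
      forall c, c < N -> path_of M a c = Nat.testbit u c.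
Proof.
  change ((forall a, st_dom M a -> sat M (scons a env) (neqs i (lits u N))) <->
  ~ exists a, st_dom M a /\ (forall k, k < i -> a <> env k) /\
      forall c, c < N -> path_of M a c = Nat.testbit u c).
  split.
  - intros H [a [Ha [Hk Hc]]]. specialize (H a Ha).
    rewrite sat_neqs, sat_lits in H. apply H; auto.
  - intros H a Ha. rewrite sat_neqs, sat_lits. intros Hk Hc. apply H. exists a. auto.
Qed.

Lemma models_saturated (B : nat -> nat -> bool) {A : Type} (M : structure A) :
  models lang (theory B) M -> saturated B M.
Proof.
  intros [[[a0 Ha0] _] HT].
  assert (forall i env, sat M env (axm B i)) as Hax.
  { intros i env. apply HT; [apply axm_sentence|]. apply theoryP. eauto. }
  split.
  - intros a N Ha. destruct (pattern_code (path_of M a) N) as [u Hu].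
    apply (Adm_ext B (Nat.testbit u)); [exact Hu|].
    apply admbP. apply Bool.not_false_is_true. intros E.
    specialize (Hax (cpair (cpair u N) 0) (fun _ => a0)).
    unfold axm in Hax. rewrite cfst_cpair, cfst_cpair, csnd_cpair, E in Hax.
    rewrite sat_alls in Hax. specialize (Hax (fun _ => a0)).
    rewrite sat_no_elt in Hax. apply Hax; auto.
    exists a. split; [exact Ha|split; [|intros; symmetry; auto]].
    intros k Hk. lia.
  - intros x N l Hx Hl. destruct (pattern_code x N) as [u Hu].
    (* An index of the pattern that is at least [length l], so the [i] outer quantifiers can be
       instantiated by all of [l], padded with [a0]. *)
    pose (i := cpair (cpair u N) (length l)).
    assert (length l <= i) as Hi by (pose proof (cpair_ge (cpair u N) (length l)); unfold i; lia).
    assert (admb B (Nat.testbit u) N = true) as E.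
    { apply admbP. apply (Adm_ext B x); auto. intros; symmetry; auto. }
    specialize (Hax i (fun k => nth (i + k) l a0)).
    unfold axm in Hax.
    replace (cfst i) with (cpair u N) in Hax by (unfold i; rewrite cfst_cpair; reflexivity).
    rewrite cfst_cpair, csnd_cpair, E in Hax. rewrite sat_alls in Hax.
    specialize (Hax (fun k => nth k l a0)).
    change (~ sat M (fun k => nth k l a0) (no_elt i u N)) with
      (sat M (fun k => nth k l a0) (Neg (no_elt i u N))) in Hax.
    assert (forall k, st_dom M (nth k l a0)) as Hd.
    { intros k. rewrite Forall_forall in Hl. destruct (lt_dec k (length l)).
      - apply Hl, nth_In; auto.
      - rewrite nth_overflow by lia. exact Ha0. }
    assert (~ sat M (fun k => nth k l a0) (no_elt i u N)) as G by (apply Hax; auto).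
    rewrite sat_no_elt in G. apply NNPP in G as [a [Ha [Hk Hc]]].
    exists a. split; [exact Ha|split].
    + intros Hin. apply In_nth with (d := a0) in Hin as [k [Hkl Hk']].
      apply (Hk k); [lia|auto].
    + intros c Hcl. rewrite Hc, Hu; auto.
Qed.

(* Elements of the standard model are the codes of triples [((u, N), j)] with [u] an admissible
   pattern of length [N]; the last component makes infinitely many copies. *)
Definition std_model (B : nat -> nat -> bool) : structure nat := {|
  st_dom := fun n => Adm B (Nat.testbit (cfst (cfst n))) (csnd (cfst n));
  st_rel := fun s l => match l with
                       | [n] => cut (Nat.testbit (cfst (cfst n))) (csnd (cfst n)) (csnd (csnd s)) = true
                       | _ => False
                       end;
  st_fun := fun _ _ => 0 |}.

Lemma std_path (B : nat -> nat -> bool) (n c : nat) :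
  path_of (std_model B) n c = cut (Nat.testbit (cfst (cfst n))) (csnd (cfst n)) c.
Proof.
  apply Bool.eq_iff_eq_true. unfold path_of. rewrite bool_of_PropP. simpl.
  unfold sym. unpair. reflexivity.
Qed.

Lemma std_saturated (B : nat -> nat -> bool) : saturated B (std_model B).
Proof.
  split.
  - intros n N Hn. simpl in Hn. apply (Adm_cut B _ _ N) in Hn.
    revert Hn. apply Adm_ext. intros; symmetry; apply std_path.
  - intros x N l Hx _. destruct (pattern_code x N) as [u Hu].
    (* The copy number exceeds every entry of [l], hence so does the code [n]. *)
    pose (n := cpair (cpair u N) (S (list_max l))). exists n.
    assert (cfst n = cpair u N) as En by apply cfst_cpair.
    split; [|split].
    + simpl. rewrite En. unpair. apply (Adm_ext B x); auto. intros; symmetry; auto.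
    + intros Hin. assert (Forall (fun k => k <= list_max l) l) as F by (apply list_max_le; auto).
      rewrite Forall_forall in F. apply F in Hin.
      pose proof (cpair_ge (cpair u N) (S (list_max l))). unfold n in Hin. lia.
    + intros c Hc. rewrite std_path, En. unpair. rewrite cut_lt; auto.
Qed.

Lemma L_structure_lang {A : Type} (M : structure A) (a : A) : st_dom M a -> L_structure lang M.
Proof.
  intros Ha. split; [eauto|]. intros s l Hs Hf. apply lang_inv in Hs as [Hs _]. congruence.
Qed.

Lemma saturated_models (B : nat -> nat -> bool) {A : Type} (M : structure A) :
  saturated B M -> models lang (theory B) M.
Proof.
  intros [H1 H2]. split.
  - destruct (H2 (fun _ => false) 0 []) as [a [Ha _]]; [intros c Hc; lia|auto|].
    exact (L_structure_lang M a Ha).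
  - intros f _ Hf env. apply theoryP in Hf as [i Hf]. apply enc_form_inj in Hf as <-.
    unfold axm. rewrite sat_alls. intros env' Hd _.
    destruct (admb B _ _) eqn:E.
    + intros G. rewrite sat_no_elt in G. apply G.
      apply admbP in E. destruct (H2 _ _ (map env' (seq 0 i)) E) as [a [Ha [Hl Hc]]].
      * rewrite Forall_forall. intros a Ha. apply in_map_iff in Ha as [k [<- Hk]].
        apply in_seq in Hk. apply Hd. lia.
      * exists a. split; [exact Ha|split; [|exact Hc]]. intros k Hk ->.
        apply Hl, in_map, in_seq. lia.
    + rewrite sat_no_elt. intros [a [Ha [_ Hc]]].
      apply Bool.not_true_iff_false in E. apply E, admbP.
      apply (Adm_ext B _ _ _ Hc). auto.
Qed.

Lemma std_models (B : nat -> nat -> bool) : models lang (theory B) (std_model B).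
Proof. apply saturated_models, std_saturated. Qed.

Fixpoint node_bound (f : form) : nat :=
  match f with
  | Bot | Eq _ _ => 0
  | Rel s _ => S (csnd (csnd s))
  | Imp f g => Nat.max (node_bound f) (node_bound g)
  | All f => node_bound f
  end.

(* Restricted to the first [N] nodes, each admissible pattern is realized infinitely often and no
   other pattern is realized, so the quantifier step only needs an element outside a finite list. *)
Lemma back_and_forth (B : nat -> nat -> bool) {A A' : Type} (M : structure A) (M' : structure A')
  (N : nat) (HM : saturated B M) (HM' : saturated B M') (f : form) :
  forall n env env', node_bound f <= N -> wf_form lang n f ->
  (forall i, i < n -> st_dom M (env i)) -> (forall i, i < n -> st_dom M' (env' i)) ->
  (forall i j, i < n -> j < n -> (env i = env j <-> env' i = env' j)) ->
  (forall i c, i < n -> c < N -> path_of M (env i) c = path_of M' (env' i) c) ->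
  (sat M env f <-> sat M' env' f).
Proof.
  induction f as [|t u|s ts|f IHf g IHg|f IHf]; intros n env env' HN Hwf Hd Hd' He Hc.
  - reflexivity.
  - destruct Hwf as [H1 H2]. apply wf_term_inv in H1 as [i [Hi ->]], H2 as [j [Hj ->]].
    apply He; auto.
  - apply wf_rel_inv in Hwf as [Hs [i [Hi ->]]]. simpl in HN. rewrite Hs.
    change (sat M env (visit (csnd (csnd s)) i) <-> sat M' env' (visit (csnd (csnd s)) i)).
    rewrite !sat_visit, Hc by auto. reflexivity.
  - destruct Hwf as [H1 H2]. simpl in HN.
    pose proof (IHf n env env' ltac:(lia) H1 Hd Hd' He Hc).
    pose proof (IHg n env env' ltac:(lia) H2 Hd Hd' He Hc). simpl. tauto.
  - simpl in HN, Hwf.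
    assert (forall a a', st_dom M a -> st_dom M' a' ->
      (forall i, i < n -> (a = env i <-> a' = env' i)) ->
      (forall c, c < N -> path_of M a c = path_of M' a' c) ->
      (sat M (scons a env) f <-> sat M' (scons a' env') f)) as G.
    { intros a a' Ha Ha' Hae Hac. apply (IHf (S n)); auto.
      - intros [|i] Hi; simpl; auto. apply Hd; lia.
      - intros [|i] Hi; simpl; auto. apply Hd'; lia.
      - intros [|i] [|j] Hi Hj; simpl.
        + split; reflexivity.
        + apply Hae; lia.
        + split; intros E; symmetry; apply Hae; auto; lia.
        + apply He; lia.
      - intros [|i] c Hi Hcc; simpl; auto. apply Hc; lia. }
    (* An element already named is matched with its partner; only a new one calls for a fresh
       element with the same pattern below [N]. *)
    assert (forall (P : nat -> Prop), (exists i, i < n /\ P i) \/ (forall i, i < n -> ~ P i)) as D.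
    { intros P. destruct (classic (exists i, i < n /\ P i)); [auto|right].
      intros i Hi HP. eauto. }
    simpl. split; intros H a Ha.
    + destruct (D (fun i => a = env' i)) as [[i [Hi ->]]|Hn].
      * apply (G (env i)); auto.
      * destruct HM as [_ HM]. destruct HM' as [HM' _].
        destruct (HM (path_of M' a) N (map env (seq 0 n)) (HM' a N Ha)) as [b [Hb [Hl Hbc]]].
        { rewrite Forall_forall. intros b Hb. apply in_map_iff in Hb as [k [<- Hk]].
          apply in_seq in Hk. apply Hd. lia. }
        apply (G b); auto. intros i Hi. split; intros E; exfalso.
        { apply Hl. rewrite E. apply in_map, in_seq. lia. }
        { apply (Hn i Hi E). }
    + destruct (D (fun i => a = env i)) as [[i [Hi ->]]|Hn].
      * apply (G (env i) (env' i)); auto.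
      * destruct HM' as [_ HM']. destruct HM as [HM _].
        destruct (HM' (path_of M a) N (map env' (seq 0 n)) (HM a N Ha)) as [b [Hb [Hl Hbc]]].
        { rewrite Forall_forall. intros b Hb. apply in_map_iff in Hb as [k [<- Hk]].
          apply in_seq in Hk. apply Hd'. lia. }
        apply (G a b); auto.
        { intros i Hi. split; intros E; exfalso.
          - apply (Hn i Hi E).
          - apply Hl. rewrite E. apply in_map, in_seq. lia. }
        intros; symmetry; auto.
Qed.

(** With no elements named, back-and-forth makes all models elementarily equivalent, so truth in the
    standard model decides each sentence. *)
Lemma complete (B : nat -> nat -> bool) : complete_theory lang (theory B).
Proof.
  split; [|split].
  - intros c Hc. apply theoryP in Hc as [i <-]. exists (axm B i). split; [reflexivity|apply axm_sentence].
  - intros H. destruct (std_saturated B) as [_ Hs].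
    destruct (Hs (fun _ => false) 0 []) as [a [Ha _]]; [intros c Hc; lia|auto|].
    exact (H nat (std_model B) (std_models B) (fun _ => a) (fun _ => Ha)).
  - intros f Hf. assert (forall A (M : structure A) env, models lang (theory B) M ->
      (sat (std_model B) (fun _ => 0) f <-> sat M env f)) as G.
    { intros A M env HM. apply (back_and_forth B) with (N := node_bound f) (n := 0);
        auto using std_saturated, models_saturated; intros; lia. }
    destruct (classic (sat (std_model B) (fun _ => 0) f)) as [H|H]; [left|right];
      intros A M HM env _; simpl; rewrite <- (G A M env HM); exact H.
Qed.

Definition conj_form (fs : list form) : form :=
  fold_right (fun f g => Neg (Imp f (Neg g))) (Neg Bot) fs.

Lemma sat_conj_form {A : Type} (M : structure A) (env : nat -> A) (fs : list form) :
  sat M env (conj_form fs) <-> forall f, In f fs -> sat M env f.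
Proof.
  induction fs as [|f fs IH].
  - split; [intros _ f []|]. intros _ F; exact F.
  - change (((sat M env f -> sat M env (conj_form fs) -> False) -> False) <->
            (forall g, In g (f :: fs) -> sat M env g)).
    split.
    + intros H g Hg. apply NNPP. intros F. apply H. intros H1 H2.
      destruct Hg as [->|Hg]; auto. apply F. apply IH; auto.
    + intros H F. apply F; [apply H; simpl; auto|]. apply IH. intros; apply H; simpl; auto.
Qed.

Lemma wf_conj_form (n : nat) (fs : list form) :
  (forall f, In f fs -> wf_form lang n f) -> wf_form lang n (conj_form fs).
Proof.
  induction fs as [|f fs IH]; intros H; simpl; auto.
  repeat split; [apply H; simpl; auto|]. apply IH. intros; apply H; simpl; auto.
Qed.

(** The finite patterns and the equality type of a tuple are expressible; the atoms constructed
    below have this form. *)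
Lemma describe (n N : nat) (x : nat -> nat -> bool) (e : nat -> nat -> bool) :
  exists f, wf_form lang n f /\ forall A (M : structure A) env,
    sat M env f <->
    (forall i c, i < n -> c < N -> path_of M (env i) c = x i c) /\
    (forall i j, i < n -> j < n -> (env i = env j <-> e i j = true)).
Proof.
  pose (eql := fun i j => if e i j then Eq (Var i) (Var j) else Neg (Eq (Var i) (Var j))).
  exists (conj_form (map (fun p => lit (x (fst p) (snd p)) (snd p) (fst p)) (list_prod (seq 0 n) (seq 0 N))
             ++ map (fun p => eql (fst p) (snd p)) (list_prod (seq 0 n) (seq 0 n)))).
  split.
  - apply wf_conj_form. intros f Hf. apply in_app_or in Hf as [Hf|Hf];
      apply in_map_iff in Hf as [[i c] [<- Hp]]; apply in_prod_iff in Hp as [Hi Hc];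
      apply in_seq in Hi, Hc; simpl.
    + apply wf_lit. lia.
    + unfold eql. destruct (e i c); simpl; repeat split; lia.
  - intros A M env. rewrite sat_conj_form.
    assert (forall i j, sat M env (eql i j) <-> (env i = env j <-> e i j = true)) as He.
    { intros i j. unfold eql. destruct (e i j); simpl; intuition congruence. }
    split.
    + intros H. split.
      * intros i c Hi Hc. apply sat_lit. apply H. apply in_or_app; left.
        apply (in_map_iff (fun p => lit (x (fst p) (snd p)) (snd p) (fst p))).
        exists (i, c). split; [reflexivity|]. apply in_prod; apply in_seq; lia.
      * intros i j Hi Hj. apply He. apply H. apply in_or_app; right.
        apply (in_map_iff (fun p => eql (fst p) (snd p))).
        exists (i, j). split; [reflexivity|]. apply in_prod; apply in_seq; lia.
    + intros [H1 H2] f Hf. apply in_app_or in Hf as [Hf|Hf];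
      apply in_map_iff in Hf as [[i c] [<- Hp]]; apply in_prod_iff in Hp as [Hi Hc];
      apply in_seq in Hi, Hc; simpl.
      * apply sat_lit, H1; lia.
      * apply He, H2; lia.
Qed.

(** An isolated point of the closed set of admissible paths, together with the length of an
    isolating initial segment. *)
Definition isolates (B : nat -> nat -> bool) (x : nat -> bool) (N : nat) : Prop :=
  (forall K, Adm B x K) /\
  forall y, (forall K, Adm B y K) -> (forall c, c < N -> y c = x c) -> forall c, y c = x c.

Lemma saturated_realize (B : nat -> nat -> bool) {A : Type} (M : structure A) (HM : saturated B M)
  (n N : nat) (x : nat -> nat -> bool) (e : nat -> A) :
  (forall i, Adm B (x i) N) -> (forall i j, e i = e j -> x i = x j) ->
  exists env, env_in M env /\
    (forall i c, i < n -> c < N -> path_of M (env i) c = x i c) /\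
    (forall i j, i < n -> j < n -> (env i = env j <-> e i = e j)).
Proof.
  intros Hx Hex. destruct HM as [_ HM].
  induction n as [|n [env [Hd [Hc He]]]].
  - destruct (HM (x 0) N [] (Hx 0)) as [a [Ha _]]; [auto|].
    exists (fun _ => a). split; [intros i; exact Ha|split; intros; lia].
  - assert (exists a, st_dom M a /\ (forall c, c < N -> path_of M a c = x n c) /\
              forall i, i < n -> (env i = a <-> e i = e n)) as [a [Ha [Hac Hae]]].
    { destruct (classic (exists i, i < n /\ e i = e n)) as [[i [Hi E]]|Hn].
      - exists (env i). split; [apply Hd|split].
        + intros c Hcl. rewrite Hc by auto. rewrite (Hex _ _ E). reflexivity.
        + intros j Hj. rewrite He by auto. rewrite E. reflexivity.
      - destruct (HM (x n) N (map env (seq 0 n)) (Hx n)) as [a [Ha [Hl Hac]]].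
        { rewrite Forall_forall. intros b Hb. apply in_map_iff in Hb as [k [<- Hk]]. apply Hd. }
        exists a. split; [exact Ha|split; [exact Hac|]].
        intros i Hi. split; intros E; exfalso.
        + apply Hl. rewrite <- E. apply in_map, in_seq. lia.
        + eauto. }
    exists (fun i => if i =? n then a else env i). split; [|split].
    + intros i. destruct (i =? n); auto.
    + intros i c Hi Hcl. destruct (Nat.eqb_spec i n) as [->|]; [auto|]. apply Hc; lia.
    + intros i j Hi Hj. destruct (Nat.eqb_spec i n) as [->|]; destruct (Nat.eqb_spec j n) as [->|].
      * split; reflexivity.
      * split; intros E; symmetry; apply Hae; auto; lia.
      * apply Hae; lia.
      * apply He; lia.
Qed.

(** A tuple satisfying [g] matters to [g] only below [node_bound g], so each of its paths may be
    replaced by an isolated one. Describing these up to [K], along with the equality type, pins down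
    the whole paths in every model, and back-and-forth then decides every formula. *)
Lemma atomic (B : nat -> nat -> bool) :
  (forall x N, Adm B x N -> exists y K, (forall c, c < N -> y c = x c) /\ isolates B y K) ->
  atomic_theory lang (theory B).
Proof.
  intros Hiso n g Hg Hcons.
  assert (exists (A : Type) (M : structure A) (env : nat -> A),
     models lang (theory B) M /\ env_in M env /\ sat M env g) as [A [M [env [HM [Hd Hs]]]]].
  { apply NNPP. intros F. apply Hcons. intros A M HM env Hd Hs. apply F. exists A, M, env. auto. }
  pose proof (models_saturated B M HM) as Sat.
  pose (N := node_bound g).
  assert (forall x, exists p : (nat -> bool) * nat, Adm B x N ->
     (forall c, c < N -> fst p c = x c) /\ isolates B (fst p) (snd p)) as Hp.
  { intros x. destruct (classic (Adm B x N)) as [H|H].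
    - destruct (Hiso x N H) as [y [K H']]. exists (y, K). auto.
    - exists (x, 0). intros; contradiction. }
  (* The isolated path is chosen as a function of the original path and not of the index, so that
     equal elements receive equal paths. *)
  pose (F := fun x => epsilon (inhabits ((fun _ => false), 0)) (fun p : (nat -> bool) * nat => Adm B x N ->
     (forall c, c < N -> fst p c = x c) /\ isolates B (fst p) (snd p))).
  assert (forall x, Adm B x N -> (forall c, c < N -> fst (F x) c = x c) /\
            isolates B (fst (F x)) (snd (F x))) as HF.
  { intros x. apply (epsilon_spec (inhabits ((fun _ => false), 0)) _ (Hp x)). }
  pose (x := fun i => fst (F (path_of M (env i)))).
  assert (exists K, forall i, i < n -> snd (F (path_of M (env i))) <= K) as [K HK].
  { exists (list_max (map (fun i => snd (F (path_of M (env i)))) (seq 0 n))). intros i Hi.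
    assert (Forall (fun k => k <= list_max (map (fun i => snd (F (path_of M (env i)))) (seq 0 n)))
              (map (fun i => snd (F (path_of M (env i)))) (seq 0 n))) as G by (apply list_max_le; auto).
    rewrite Forall_forall in G. apply G.
    apply (in_map (fun i => snd (F (path_of M (env i))))), in_seq. lia. }
  assert (forall i, (forall c, c < N -> x i c = path_of M (env i) c) /\
            isolates B (x i) (snd (F (path_of M (env i))))) as Hx.
  { intros i. apply HF. apply Sat, Hd. }
  destruct (describe n K x (fun i j => bool_of_Prop (env i = env j))) as [f [Hwf Hf]].
  assert (forall A' (M' : structure A') env', models lang (theory B) M' -> env_in M' env' ->
    sat M' env' f -> (forall i c, i < n -> path_of M' (env' i) c = x i c) /\
    (forall i j, i < n -> j < n -> (env i = env j <-> env' i = env' j))) as Hf1.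
  { intros A' M' env' HM' Hd' H. apply Hf in H as [H1 H2]. split.
    - intros i c Hi. destruct (Hx i) as [_ [_ Hu]]. apply Hu.
      + intros L. apply (models_saturated B M' HM'), Hd'.
      + intros d Hdl. apply H1; auto. specialize (HK i Hi). lia.
    - intros i j Hi Hj. rewrite H2, bool_of_PropP by auto. reflexivity. }
  (* A tuple satisfying [f] is needed to exclude that [f] implies both a formula and its
     negation. *)
  destruct (saturated_realize B M Sat n K x env) as [env0 [Hd0 [Hc0 He0]]].
  { intros i. apply Hx. }
  { intros i j E. unfold x. rewrite E. reflexivity. }
  assert (sat M env0 f) as Hs0.
  { apply Hf. split; auto. intros i j Hi Hj. rewrite bool_of_PropP. apply He0; auto. }
  exists f. split; [split; [exact Hwf|]|].
  - intros h Hh.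
    assert (forall A' (M' : structure A') env', models lang (theory B) M' -> env_in M' env' ->
      sat M' env' f -> (sat M env0 h <-> sat M' env' h)) as G.
    { intros A' M' env' HM' Hd' H.
      destruct (Hf1 A' M' env' HM' Hd' H) as [H1 H2].
      destruct (Hf1 A M env0 HM Hd0 Hs0) as [H3 H4].
      apply (back_and_forth B M M' (node_bound h)) with (n := n);
        auto using models_saturated.
      - intros i j Hi Hj. rewrite <- H2, <- H4 by auto. reflexivity.
      - intros i c Hi _. rewrite H1, H3; auto. }
    destruct (classic (sat M env0 h)) as [H|H]; [left|right]; split.
    + intros A' M' HM' env' Hd' Hs'. apply (G A' M' env' HM' Hd' Hs'), H.
    + intros P. exact (P A M HM env0 Hd0 Hs0 H).
    + intros P. apply H. exact (P A M HM env0 Hd0 Hs0).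
    + intros A' M' HM' env' Hd' Hs' C. apply H. apply (G A' M' env' HM' Hd' Hs'), C.
  - intros A' M' HM' env' Hd' Hs'. destruct (Hf1 A' M' env' HM' Hd' Hs') as [H1 H2].
    apply (back_and_forth B M M' N Sat (models_saturated B M' HM') g n env env'); auto.
    intros i c Hi Hc. rewrite H1 by auto. symmetry. apply (Hx i). exact Hc.
Qed.

(* An atom satisfied by [a] mentions only finitely many nodes and decides all others. *)
Lemma atomic_model_isolated (B : nat -> nat -> bool) {A : Type} (M : structure A) (a : A) :
  atomic_model lang (theory B) M -> st_dom M a ->
  exists N, forall y K, Adm B y K -> (forall c, c < N -> y c = path_of M a c) ->
    N <= K -> forall c, c < K -> y c = path_of M a c.
Proof.
  intros [HM Hat] Ha. pose proof (models_saturated B M HM) as Sat.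
  destruct (Hat [a] a) as [f [[Hwf Hf] Hs]]; [auto|]. simpl in Hwf, Hf.
  exists (node_bound f). intros y K Hy Hya HK c Hc.
  (* Saturation realizes finite patterns only, which is why the isolation obtained here concerns
     patterns of finite length [K]. *)
  destruct (proj2 Sat y K [] Hy) as [b [Hb [_ Hby]]]; [auto|].
  rewrite <- Hby by auto.
  assert (forall d, env_in M (fun i => nth i [d] d) <-> st_dom M d) as Henv.
  { intros d. split; [intros H; exact (H 0)|]. intros H [|[|i]]; exact H. }
  assert (sat M (fun i => nth i [b] b) f) as Hsb.
  { refine (proj1 (back_and_forth B M M (node_bound f) Sat Sat f 1 (fun i => nth i [a] a)
              (fun i => nth i [b] b) (le_n _) Hwf _ _ _ _) Hs).
    - intros i Hi. apply Henv, Ha.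
    - intros i Hi. apply Henv, Hb.
    - intros [|i] [|j] Hi Hj; try lia. split; reflexivity.
    - intros [|i] d Hi Hd; [|lia]. simpl. rewrite Hby by lia. symmetry. auto. }
  apply Bool.eq_iff_eq_true.
  destruct (Hf (visit c 0)) as [[P _]|[_ P]]; [apply wf_visit; auto| |].
  - pose proof (P A M HM _ (proj2 (Henv a) Ha) Hs) as Q1.
    pose proof (P A M HM _ (proj2 (Henv b) Hb) Hsb) as Q2.
    apply sat_visit in Q1, Q2. simpl in Q1, Q2. rewrite Q1, Q2. reflexivity.
  - pose proof (P A M HM _ (proj2 (Henv a) Ha) Hs) as Q1.
    pose proof (P A M HM _ (proj2 (Henv b) Hb) Hsb) as Q2.
    change (~ sat M (fun i => nth i [a] a) (visit c 0)) in Q1.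
    change (~ sat M (fun i => nth i [b] b) (visit c 0)) in Q2.
    rewrite sat_visit in Q1, Q2. simpl in Q1, Q2. tauto.
Qed.

(** * Computability of the theory *)

Lemma enc_visit (c i : nat) :
  enc_form (visit c i) = cpair 2 (cpair (cpair 0 (cpair 1 c)) (S (cpair (cpair 0 i) 0))).
Proof. reflexivity. Qed.

Lemma RecB_admb (X : set) (B : nat -> nat -> bool) (f g : nat -> nat) :
  RecB X (fun z => B (cfst z) (csnd z)) -> Rec X f -> Rec X g ->
  RecB X (fun n => admb B (Nat.testbit (f n)) (g n)).
Proof.
  intros HB Hf Hg.
  apply Rec_ext with (f := fun n => nat_rec (fun _ => nat) 1
    (fun c v => if Nat.testbit (f n) c
                then if B (last_node (Nat.testbit (f n)) c) c then v else 0 else v) (g n)).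
  - intros n. generalize (g n) as N, (Nat.testbit (f n)) as x. intros N x.
    induction N as [|N IH]; [reflexivity|].
    transitivity (if x N then if B (last_node x N) N then (if admb B x N then 1 else 0) else 0
                  else if admb B x N then 1 else 0); [rewrite <- IH; reflexivity|].
    change (admb B x (S N))
      with (if x N then andb (admb B x N) (B (last_node x N) N) else admb B x N).
    destruct (x N), (admb B x N), (B (last_node x N) N); reflexivity.
  - assert (forall h, Rec X h -> Rec X (fun n => f (h n))) as Hf' by (intros h Hh; exact (Rec_comp X f h Hf Hh)).
    apply (Rec_rec X (fun _ => 1) g (fun n c v => if Nat.testbit (f n) c
                then if B (last_node (Nat.testbit (f n)) c) c then v else 0 else v));
      auto with rec.
    apply Rec_if; [|apply Rec_if|]; auto 10 using RecB_testbit with rec.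
    apply (RecB_curry X B); auto with rec. unfold last_node.
    apply (Rec_rec X (fun _ => 0) (fun z => cfst (csnd z))
             (fun z c v => if Nat.testbit (f (cfst z)) c then S c else v)); auto with rec.
    auto 10 using RecB_testbit with rec.
Qed.

(** The recursion that defines the formula is repeated on codes; [neqs] and [alls] are treated
    likewise. *)
Lemma Rec_enc_lits (X : set) (f g : nat -> nat) :
  Rec X f -> Rec X g -> Rec X (fun n => enc_form (lits (f n) (g n))).
Proof.
  intros Hf Hg.
  pose (V := fun c => cpair 2 (cpair (cpair 0 (cpair 1 c)) (S (cpair (cpair 0 0) 0)))).
  apply Rec_ext with (f := fun n => nat_rec (fun _ => nat) (cpair 0 0)
    (fun c v => cpair 3 (cpair (if Nat.testbit (f n) c then V c else cpair 3 (cpair (V c) (cpair 0 0))) v))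
    (g n)).
  - intros n. generalize (g n) as N, (f n) as u. intros N u.
    induction N as [|N IH]; [reflexivity|].
    change (lits u (S N)) with (Imp (lit (Nat.testbit u N) N 0) (lits u N)).
    cbn [enc_form]. rewrite <- IH. unfold lit.
    destruct (Nat.testbit u N) eqn:E; cbn [nat_rec nat_rect]; rewrite E; reflexivity.
  - assert (forall h, Rec X h -> Rec X (fun n => f (h n))) as Hf' by (intros h Hh; exact (Rec_comp X f h Hf Hh)).
    apply (Rec_rec X (fun _ => cpair 0 0) g (fun n c v =>
      cpair 3 (cpair (if Nat.testbit (f n) c then V c else cpair 3 (cpair (V c) (cpair 0 0))) v)));
      auto with rec.
    unfold V. auto 30 using RecB_testbit with rec.
Qed.

Lemma Rec_enc_neqs (X : set) (i : nat -> nat) (F : nat -> form) :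
  Rec X i -> Rec X (fun n => enc_form (F n)) -> Rec X (fun n => enc_form (neqs (i n) (F n))).
Proof.
  intros Hi HF.
  pose (E := fun k => cpair 3 (cpair (cpair 1 (cpair (cpair 0 0) (cpair 0 (S k)))) (cpair 0 0))).
  apply Rec_ext with (f := fun n => nat_rec (fun _ => nat) (enc_form (F n))
    (fun k v => cpair 3 (cpair (E k) v)) (i n)).
  - intros n. generalize (i n) as m, (F n) as f. intros m f.
    induction m as [|m IH]; [reflexivity|].
    change (neqs (S m) f) with (Imp (Neg (Eq (Var 0) (Var (S m)))) (neqs m f)).
    cbn [enc_form]. rewrite <- IH. reflexivity.
  - apply (Rec_rec X (fun n => enc_form (F n)) i (fun _ k v => cpair 3 (cpair (E k) v))); auto.
    unfold E. auto 30 with rec.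
Qed.

Lemma Rec_enc_alls (X : set) (i : nat -> nat) (F : nat -> form) :
  Rec X i -> Rec X (fun n => enc_form (F n)) -> Rec X (fun n => enc_form (alls (i n) (F n))).
Proof.
  intros Hi HF.
  apply Rec_ext with (f := fun n => nat_rec (fun _ => nat) (enc_form (F n))
    (fun _ v => cpair 4 v) (i n)).
  - intros n. generalize (i n) as m, (F n) as f. intros m f.
    induction m as [|m IH]; [reflexivity|].
    change (alls (S m) f) with (All (alls m f)).
    cbn [enc_form]. rewrite <- IH. reflexivity.
  - apply (Rec_rec X (fun n => enc_form (F n)) i (fun _ _ v => cpair 4 v)); auto with rec.
Qed.

Lemma Rec_enc_axm (X : set) (B : nat -> nat -> bool) :
  RecB X (fun z => B (cfst z) (csnd z)) -> Rec X (fun i => enc_form (axm B i)).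
Proof.
  intros HB. unfold axm. apply (Rec_enc_alls X (fun i => i)); [apply Rec_id|].
  apply Rec_ext with (f := fun i => if admb B (Nat.testbit (cfst (cfst i))) (csnd (cfst i))
    then cpair 3 (cpair (enc_form (no_elt i (cfst (cfst i)) (csnd (cfst i)))) (cpair 0 0))
    else enc_form (no_elt 0 (cfst (cfst i)) (csnd (cfst i)))).
  - intros i. destruct (admb _ _ _); reflexivity.
  - assert (forall h, Rec X h -> Rec X (fun i => enc_form (no_elt (h i) (cfst (cfst i)) (csnd (cfst i))))) as H.
    { intros h Hh. apply (Rec_cpair X (fun _ => 4)); [apply Rec_const|].
      apply Rec_enc_neqs; auto. apply Rec_enc_lits; auto with rec. }
    apply Rec_if; auto using RecB_admb with rec.
Qed.

Lemma RecB_theory (X : set) (B : nat -> nat -> bool) :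
  RecB X (fun z => B (cfst z) (csnd z)) -> RecB X (theory B).
Proof.
  intros HB. pose proof (Rec_enc_axm X B HB) as H.
  apply Rec_ext with (f := fun c => nat_rec (fun _ => nat) 0
    (fun i v => if enc_form (axm B i) =? c then 1 else v) (S c)).
  - intros c. unfold theory. generalize (S c) as m. induction m as [|m IH]; [reflexivity|].
    rewrite seq_S, existsb_app.
    transitivity (if enc_form (axm B m) =? c then 1 else
      if existsb (fun i => enc_form (axm B i) =? c) (seq 0 m) then 1 else 0);
      [rewrite <- IH; reflexivity|].
    simpl. destruct (enc_form (axm B m) =? c), (existsb _ _); reflexivity.
  - apply (Rec_rec X (fun _ => 0) S (fun c i v => if enc_form (axm B i) =? c then 1 else v));
      auto with rec.
    apply Rec_if; auto with rec. apply RecB_eqb; auto with rec.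
    exact (Rec_comp X (fun i => enc_form (axm B i)) (fun z => cfst (csnd z)) H ltac:(auto with rec)).
Qed.

Lemma left_part_join (X Y : set) : left_part (join X Y) = X.
Proof.
  apply functional_extensionality. intros n. unfold left_part, join.
  rewrite Nat.odd_mul, Nat.div2_double. reflexivity.
Qed.

Lemma right_part_join (X Y : set) : right_part (join X Y) = Y.
Proof.
  apply functional_extensionality. intros n. unfold right_part, join.
  rewrite Nat.add_1_r, Nat.odd_succ, Nat.div2_succ_double, Nat.even_mul. reflexivity.
Qed.

Lemma right_part_le (X : set) : Turing_le (right_part X) X.
Proof.
  apply Turing_le_RecB. apply (Rec_orc X (fun n => 2 * n + 1)).
  apply Rec_ext with (f := fun n => S (n + n)); [intros; lia|]. auto with rec.
Qed.

Lemma computable_instance (B : nat -> nat -> bool) :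
  RecB emptyset (fun z => B (cfst z) (csnd z)) -> computable (join lang (theory B)).
Proof.
  intros HB. apply join_le; apply Turing_le_RecB.
  - unfold lang. auto with rec.
  - apply RecB_theory, HB.
Qed.

(** * Diagonalization *)

Definition edge (A : nat -> nat -> bool) (l c : nat) : bool :=
  if l =? 0 then andb (csnd (cfst c) =? 0) (csnd c =? 0)
  else andb (cfst (cfst (pred l)) =? cfst (cfst c))
         (andb (csnd (cfst (pred l)) <? csnd (cfst c)) (andb (csnd c <=? 1) (A c (pred l)))).

Lemma edge_start (A : nat -> nat -> bool) (c : nat) :
  edge A 0 c = true <-> csnd (cfst c) = 0 /\ csnd c = 0.
Proof. unfold edge. simpl. rewrite Bool.andb_true_iff, !Nat.eqb_eq. reflexivity. Qed.

Lemma edge_step (A : nat -> nat -> bool) (c0 c : nat) :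
  edge A (S c0) c = true <->
  cfst (cfst c0) = cfst (cfst c) /\ csnd (cfst c0) < csnd (cfst c) /\ csnd c <= 1 /\ A c c0 = true.
Proof.
  unfold edge. simpl. rewrite !Bool.andb_true_iff, Nat.eqb_eq, Nat.ltb_lt, Nat.leb_le. reflexivity.
Qed.

Lemma RecB_edge (X : set) (A : nat -> nat -> bool) :
  RecB X (fun z => A (cfst z) (csnd z)) -> RecB X (fun z => edge A (cfst z) (csnd z)).
Proof.
  intros HA. unfold edge.
  assert (RecB X (fun z => A (csnd z) (pred (cfst z)))) by (apply (RecB_curry X A); auto with rec).
  auto 20 with rec.
Qed.

(** The strict increase along all earlier nodes means that no pair [(n, k)] is visited with two
    flavours. *)
Lemma edge_path (A : nat -> nat -> bool) (x : nat -> bool) (Hx : forall K, Adm (edge A) x K) (c : nat) :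
  x c = true ->
  csnd c <= 1 /\
  forall d, d < c -> x d = true -> cfst (cfst d) = cfst (cfst c) /\ csnd (cfst d) < csnd (cfst c).
Proof.
  induction c as [c IH] using lt_wf_ind. intros Hc.
  pose proof (Hx (S c) c (Nat.lt_succ_diag_r c) Hc) as E.
  destruct (last_node x c) as [|c0] eqn:El.
  - apply edge_start in E as [_ E]. split; [lia|]. intros d Hd Hxd.
    destruct (last_node_pos x c d Hd Hxd). congruence.
  - apply edge_step in E as [E1 [E2 [E3 _]]]. split; [exact E3|]. intros d Hd Hxd.
    destruct (last_node_visited x c c0 El) as [L1 L2].
    destruct (Nat.lt_trichotomy d c0) as [L|[->|L]]; [|auto|].
    + destruct (IH c0 L1 L2) as [_ G]. destruct (G d L Hxd). split; [congruence|lia].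
    (* A visited node strictly between [c0] and [c] contradicts that [c0] is the last one before
       [c]. *)
    + exfalso. revert El Hd Hxd L. clear. induction c as [|c IH]; intros El Hd Hxd L; [lia|].
      rewrite last_node_S in El. destruct (x c) eqn:E.
      * injection El as ->. lia.
      * apply IH; auto. destruct (Nat.eq_dec d c); [congruence|lia].
Qed.

Definition lim_rel (A : nat -> nat -> bool) (R : nat -> Prop) : Prop :=
  forall c, exists s0, forall s, s0 <= s -> (A s c = true <-> R c).

(** Before stage [s0] the approximation may wrongly allow nodes after [c]. Prescribing no visits
    between [N] and [N + s0] excludes these, and every later node is forbidden by the settled
    approximation. *)
Lemma edge_dead_end (A : nat -> nat -> bool) (R : nat -> Prop) (x : nat -> bool) (N c : nat) :
  lim_rel A R -> Adm (edge A) x N -> last_node x N = S c -> ~ R c ->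
  exists y K, (forall d, d < N -> y d = x d) /\ isolates (edge A) y K.
Proof.
  intros HA Hx Hl HR. destruct (HA c) as [s0 Hs0].
  exists (cut x N), (N + s0). split; [intros; apply cut_lt; auto|].
  split; [intros K; apply Adm_cut; auto|].
  intros y Hy Hyx. assert (forall d, N + s0 <= d -> y d = false) as G.
  { intros d. induction d as [d IH] using lt_wf_ind. intros Hd.
    apply Bool.not_true_is_false. intros E. apply HR, (Hs0 d); [lia|].
    assert (last_node y d = S c) as El.
    { rewrite (last_node_gap y N d); [|lia|].
      - rewrite (last_node_ext y x); auto. intros. rewrite Hyx by lia. apply cut_lt; auto.
      - intros e He1 He2. destruct (lt_dec e (N + s0)).
        + rewrite Hyx by lia. apply cut_ge; auto.
        + apply IH; lia. }
    pose proof (Hy (S d) d (Nat.lt_succ_diag_r d) E) as Ed. rewrite El in Ed.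
    apply edge_step in Ed. tauto. }
  intros d. destruct (lt_dec d (N + s0)); [apply Hyx; auto|].
  rewrite G, cut_ge by lia. reflexivity.
Qed.

(** A node with large [k] has a code beyond both [N] and the stage at which the approximation
    settles on [c] being live. *)
Lemma edge_successor (A : nat -> nat -> bool) (R : nat -> Prop) (c N b : nat) :
  lim_rel A R -> R c -> b <= 1 ->
  exists k0, forall k, k0 <= k -> N <= cpair (cpair (cfst (cfst c)) k) b /\
    edge A (S c) (cpair (cpair (cfst (cfst c)) k) b) = true.
Proof.
  intros HA HR Hb. destruct (HA c) as [s0 Hs0]. exists (S (N + s0 + csnd (cfst c))).
  intros k Hk.
  pose proof (cpair_ge (cpair (cfst (cfst c)) k) b). pose proof (cpair_ge (cfst (cfst c)) k).
  split; [lia|]. apply edge_step. unpair. repeat split; auto; [lia|]. apply Hs0; auto. lia.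
Qed.

(* [R] picks at most one of the two flavours of each node, so a live node always has a successor
   that is a dead end. *)
Lemma edge_isolated_dense (A : nat -> nat -> bool) (R : nat -> Prop) :
  lim_rel A R -> (forall z, ~ (R (cpair z 0) /\ R (cpair z 1))) ->
  forall x N, Adm (edge A) x N ->
    exists y K, (forall c, c < N -> y c = x c) /\ isolates (edge A) y K.
Proof.
  intros HA HR.
  assert (forall x N c, Adm (edge A) x N -> last_node x N = S c ->
    exists y K, (forall c, c < N -> y c = x c) /\ isolates (edge A) y K) as G.
  { intros x N c Hx Hl. destruct (classic (R c)) as [Hc|Hc]; [|eapply edge_dead_end; eauto].
    destruct (edge_successor A R c N 0 HA Hc) as [k0 H0]; [lia|].
    destruct (edge_successor A R c N 1 HA Hc) as [k1 H1]; [lia|].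
    pose (z := cpair (cfst (cfst c)) (k0 + k1)).
    assert (exists b, ~ R (cpair z b) /\ N <= cpair z b /\ edge A (S c) (cpair z b) = true)
      as [b [Hb [HN He]]].
    { destruct (classic (R (cpair z 0))) as [H|H].
      - exists 1. split; [intros F; apply (HR z); auto|]. apply H1; lia.
      - exists 0. split; [exact H|]. apply H0; lia. }
    rewrite <- Hl in He. destruct (Adm_extend _ _ _ _ Hx HN He) as [y [Hyx [_ [Hy Hly]]]].
    destruct (edge_dead_end A R y _ _ HA Hy Hly Hb) as [w [K [Hw HK]]].
    exists w, K. split; [|exact HK]. intros d Hd. rewrite Hw by lia. auto. }
  intros x N Hx. destruct (last_node x N) as [|c] eqn:El; [|eauto].
  pose (c := cpair (cpair N 0) 0).
  assert (N <= c) as HN.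
  { unfold c. pose proof (cpair_ge (cpair N 0) 0). pose proof (cpair_ge N 0). lia. }
  assert (edge A (last_node x N) c = true) as He.
  { rewrite El. apply edge_start. unfold c. unpair. auto. }
  destruct (Adm_extend _ _ _ _ Hx HN He) as [y [Hyx [_ [Hy Hly]]]].
  destruct (G y _ _ Hy Hly) as [w [K [Hw HK]]].
  exists w, K. split; [|exact HK]. intros d Hd. rewrite Hw by lia. auto.
Qed.

(** If the first [N] nodes determined the path, comparison with its cut at [N] would make it end
    before [N]; but its last node is live and allows a successor beyond [N]. The visited [c]
    guarantees that there is a last node. *)
Lemma edge_live_path (A : nat -> nat -> bool) (R : nat -> Prop) (x : nat -> bool) (c N : nat) :
  lim_rel A R -> (forall K, Adm (edge A) x K) -> x c = true -> (forall d, x d = true -> R d) ->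
  ~ forall y K, Adm (edge A) y K -> (forall d, d < N -> y d = x d) -> N <= K ->
      forall d, d < K -> y d = x d.
Proof.
  intros HA Hx Hc HR H.
  assert (forall d, N <= d -> x d = false) as H0.
  { intros d Hd. rewrite <- (cut_ge x N d Hd). symmetry. apply (H (cut x N) (S d)); try lia.
    - apply Adm_cut, Hx.
    - intros; apply cut_lt; auto. }
  assert (c < N) as HcN.
  { destruct (lt_dec c N); auto. rewrite H0 in Hc by lia. discriminate. }
  destruct (last_node_pos x N c HcN Hc) as [c0 El].
  destruct (last_node_visited x N c0 El) as [_ Hc0].
  destruct (edge_successor A R c0 N 0 HA (HR _ Hc0)) as [k0 Hk]; [lia|].
  destruct (Hk k0 (le_n _)) as [HN He]. rewrite <- El in He.
  destruct (Adm_extend _ _ _ _ (Hx N) HN He) as [y [Hyx [Hyc [Hy _]]]].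
  rewrite (H y _ Hy) in Hyc; [|auto|lia|lia]. rewrite H0 in Hyc by auto. discriminate.
Qed.

Lemma least_witness (P : nat -> bool) (n : nat) :
  P n = true -> exists m, P m = true /\ forall i, i < m -> P i = false.
Proof.
  induction n as [n IH] using lt_wf_ind. intros Hn.
  destruct (classic (exists m, m < n /\ P m = true)) as [[m [Hm HP]]|H]; [eauto|].
  exists n. split; [exact Hn|]. intros i Hi. apply Bool.not_true_is_false. eauto.
Qed.

(** The number [S (cpair a 0)] codes the one-element tuple [[a]]. Visits are thus read off the
    diagram, so a solution computes the path of each element. *)
Lemma diagram_visit (X : set) (M : structure nat) (c a : nat) :
  (forall c, X c = true <->
      exists f l, c = cpair (enc_form f) (enc_list l) /\
                  wf_form lang (length l) f /\ Forall (st_dom M) l /\ sat M (env_of_list l) f) ->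
  X (cpair (enc_form (visit c 0)) (S (cpair a 0))) = true <->
  st_dom M a /\ path_of M a c = true.
Proof.
  intros HX. rewrite HX. split.
  - intros [f [l [E [_ [Hd Hs]]]]]. apply cpair_inj in E as [E1 E2].
    apply enc_form_inj in E1 as <-. change (S (cpair a 0)) with (enc_list (map (fun n => n) [a])) in E2.
    rewrite <- (map_id l) in E2. apply enc_list_inj in E2 as <-; [|auto].
    apply sat_visit in Hs. inversion Hd; subst. auto.
  - intros [Ha Hp]. exists (visit c 0), [a]. repeat split; auto.
    + apply lang_sym.
    + apply (wf_visit 1 c 0 (le_n _)).
    + apply (wf_visit 1 c 0 (le_n _)).
    + apply (wf_visit 1 c 0 (le_n _)).
    + apply sat_visit. exact Hp.
Qed.

Lemma low_not_bounds_AMT (Y : set) :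
  low Y ->
  exists X, computable X /\ AMT_inst X /\ forall W, AMT_sol X W -> ~ Turing_le W Y.
Proof.
  intros HY. destruct (low_lim Y HY) as [A [HA Hlim]].
  pose (R := fun c => conv (cfst (cfst c)) Y (cfst c) (csnd c)).
  assert (lim_rel A R) as HAR by exact Hlim.
  assert (forall z, ~ (R (cpair z 0) /\ R (cpair z 1))) as HR.
  { intros z [H0 H1]. unfold R in *. unpair. apply conv_Ev in H0, H1.
    pose proof (Ev_det _ _ _ _ _ H0 H1). discriminate. }
  exists (join lang (theory (edge A))).
  split; [apply computable_instance, RecB_edge, HA|].
  split.
  { unfold AMT_inst. rewrite left_part_join, right_part_join.
    split; [apply complete|apply atomic, (edge_isolated_dense A R); auto]. }
  intros W HW HWY. unfold AMT_sol in HW. rewrite left_part_join, right_part_join in HW.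
  destruct HW as [M [_ [HM HE]]].
  pose (E := right_part W). fold E in HE.
  assert (RecB Y E) as HEY.
  { apply Turing_le_RecB. eapply Turing_le_trans; [apply right_part_le|exact HWY]. }
  pose proof (models_saturated _ M (proj1 HM)) as Sat.
  pose (V := fun c a => E (cpair (enc_form (visit c 0)) (S (cpair a 0)))).
  assert (forall c a, V c a = true <-> st_dom M a /\ path_of M a c = true) as HV
    by (intros; apply diagram_visit, HE).
  (* A single start node is an admissible pattern for every [n], so the search that defines [h]
     always terminates. *)
  assert (forall n, exists a, V (cpair (cpair n 0) 0) a = true /\
             forall i, i < a -> V (cpair (cpair n 0) 0) i = false) as Hleast.
  { intros n. pose (c := cpair (cpair n 0) 0).
    destruct (Adm_extend (edge A) (fun _ => false) 0 c) as [y [_ [Hyc [Hy _]]]];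
      [intros d Hd; lia|lia|apply edge_start; unfold c; unpair; auto|].
    destruct (proj2 Sat y (S c) [] Hy) as [a [Ha [_ Hac]]]; [auto|].
    apply (least_witness (V c) a). apply HV. rewrite Hac by auto. auto. }
  assert (forall f g, Rec Y f -> Rec Y g -> RecB Y (fun n => V (f n) (g n))) as HVY.
  { intros f g Hf Hg. apply (RecB_comp Y E); [exact HEY|].
    apply Rec_cpair; [|auto with rec].
    apply Rec_ext with (f := fun n => cpair 2 (cpair (cpair 0 (cpair 1 (f n))) (S (cpair (cpair 0 0) 0))));
      [intros; symmetry; apply enc_visit|]. auto 20 with rec. }
  pose (h := fun n => epsilon (inhabits 0) (fun a => V (cpair (cpair n 0) 0) a = true /\
             forall i, i < a -> V (cpair (cpair n 0) 0) i = false)).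
  assert (forall n, V (cpair (cpair n 0) 0) (h n) = true /\
             forall i, i < h n -> V (cpair (cpair n 0) 0) i = false) as Hh.
  { intros n. apply (epsilon_spec (inhabits 0) _ (Hleast n)). }
  assert (Rec Y h) as Hhr.
  { apply (Rec_mu Y (fun n a => V (cpair (cpair n 0) 0) a)).
    - apply HVY; auto with rec.
    - intros n; apply Hh.
    - intros n; apply Hh. }
  (* The argument [z] is a pair [(n, k)] that carries [n], so one program serves all [n] and may be
     diagonalized against at its own index. *)
  assert (RecB Y (fun z => V (cpair z 1) (h (cfst z)))) as [q Hq].
  { apply HVY; auto with rec. apply (Rec_comp Y h); auto with rec. }
  pose (n := code q). pose (a := h n).
  destruct (proj1 (HV _ _) (proj1 (Hh n))) as [Ha Hstart]. fold a in Ha, Hstart.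
  assert (forall K, Adm (edge A) (path_of M a) K) as Hpath by (intros; apply Sat, Ha).
  destruct (atomic_model_isolated _ M a HM Ha) as [N HN].
  refine (edge_live_path A R (path_of M a) _ N HAR Hpath Hstart _ HN).
  intros c Hc. destruct (edge_path A _ Hpath c Hc) as [Hb Hlt].
  assert (cfst (cfst c) = n) as En.
  { destruct (Nat.lt_trichotomy (cpair (cpair n 0) 0) c) as [L|[<-|L]].
    - destruct (Hlt _ L Hstart) as [G _]. unpair. congruence.
    - unpair. reflexivity.
    - destruct (edge_path A _ Hpath _ Hstart) as [_ G]. destruct (G c L Hc) as [G1 _].
      unpair. exact G1. }
  unfold R. apply conv_Ev. rewrite En. unfold n. rewrite decode_code.
  (* Since [c] is visited, a visit to flavour 1 of the same pair [(n, k)] must be [c] itself: two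
     distinct visited nodes have different [k]. The answer of the program is therefore the flavour
     of [c]. *)
  assert (V (cpair (cfst c) 1) (h (cfst (cfst c))) = (csnd c =? 1)) as EV.
  { rewrite En. fold a. apply Bool.eq_iff_eq_true. rewrite HV, Nat.eqb_eq. split.
    - intros [_ H]. pose (d := cpair (cfst c) 1). fold d in H.
      assert (cfst d = cfst c) as Ed by apply cfst_cpair.
      destruct (Nat.lt_trichotomy d c) as [L|[L|L]].
      + destruct (Hlt _ L H) as [_ G]. rewrite Ed in G. lia.
      + rewrite <- L. apply csnd_cpair.
      + destruct (edge_path A _ Hpath _ H) as [_ G]. destruct (G c L Hc) as [_ G1].
        rewrite Ed in G1. lia.
    - intros H. rewrite <- H, cpair_eta. auto. }
  specialize (Hq (cfst c)). cbv beta in Hq. rewrite EV in Hq.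
  replace (csnd c) with (if csnd c =? 1 then 1 else 0); [exact Hq|].
  destruct (csnd c) as [|[|]]; [reflexivity|reflexivity|lia].
Qed.

Theorem theorem3p3 (P : principle) :
  c_reducible AMT_inst AMT_sol (is_instance P) (is_solution P) ->
  (exists M : set -> Prop,
      omega_model (is_instance P) (is_solution P) M /\
      forall X, M X -> low X) ->
  ~ admits_universal_instance (is_instance P) (is_solution P).
Proof.
  intros Hred [M [[[Z HZ] [_ [Hdown Hsol]]] Hlow]] [U [HU [HUi Huniv]]].
  destruct (Hsol U (Hdown Z U HZ (computable_le U Z HU)) HUi) as [Y [HMY HUY]].
  destruct (low_not_bounds_AMT Y (Hlow Y HMY)) as [X [HX [HXi HXsol]]].
  (* As [X] is computable, so is the instance [Y0], and [Y] has to bound a solution of it; for the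
     same reason [X] adds nothing to the join in the end. *)
  destruct (Hred X HXi) as [Y0 [HY0 [HY0i HY0sol]]].
  destruct (Huniv Y HUY Y0) as [V [HV HVsol]]; [eapply Turing_le_trans; eauto|exact HY0i|].
  destruct (HY0sol V HVsol) as [W [HW HWsol]].
  apply (HXsol W HWsol). eapply Turing_le_trans; [exact HW|].
  apply join_le; [apply computable_le; exact HX|exact HV].
Qed.
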